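(* Let $\Delta=\Delta(X,Y,T,E)$ be a tableau complex homeomorphic to a ball or a sphere, let $\mathbb{k}$ be a field and $S=\mathbb{k}[V]$ with $V=\{v_{(x,y)}:(x,y)\in E\}$. Then \[K(S/I_\Delta;\mathbf t)=\sum_F(-1)^{|F|-|X|}\prod_{x\in X}\prod_{y\in F(x)}\big(1-t_{v_{(x,y)}}\big),\] the sum over all set-valued tableaux $F\subseteq E$ with $F(x)\neq\varnothing$ for every $x\in X$ such that every tableau $f\subseteq F$ lies in $T$; here $|F|=\sum_{x\in X}|F(x)|$.
   Context: Let $X,Y$ be finite sets; a tableau is a function $f:X\to Y$ identified with its graph in $X\times Y$; a set-valued tableau is $F\subseteq X\times Y$ with $F(x)=\{y:(x,y)\in F\}$, and $f\subseteq F$ means $f(x)\in F(x)$ for all $x$. Let $T$ be a set of tableaux and $E\subseteq X\times Y$ contain every $f\in T$; put $v_{(x,y)}:=E\setminus\{(x,y)\}$. The tableau complex $\Delta(X,Y,T,E)$ is the simplicial complex on ground set $V$ whose faces are the sets $\{v_{(x,y)}:(x,y)\in E\setminus F\}$ for $F\subseteq E$ containing some $f\in T$. The Stanley–Reisner ideal $I_\Delta\subseteq S$ is generated by the monomials $\prod_{v\in G}v$ for $G\subseteq V$ not a face. With the $\mathbb Z^V$-grading (variable $v$ of degree $t_v$), $K(S/I_\Delta;\mathbf t)$ is the numerator of the Hilbert series of $S/I_\Delta$ over $\prod_{v\in V}(1-t_v)$. *)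

(* Defs.v *)
From HB Require Import structures.
From mathcomp Require Import all_boot all_order all_algebra.
From mathcomp Require Import mpoly.
From mathcomp Require Import classical_sets reals topology.

Set Implicit Arguments.
Unset Strict Implicit.
Unset Printing Implicit Defensive.

Import GRing.Theory Num.Theory.
Import numFieldTopology.Exports.

Local Open Scope ring_scope.

(* The polynomial ring A[V]: the variable attached to v : V is
   'X_(enum_rank v), and a multidegree in N^V is an 'X_{1..#|V|}. *)
Notation polyring A V := {mpoly A[#|V|]}.

Definition var (A : nzRingType) (V : finType) (v : V) : polyring A V :=
  'X_(enum_rank v).

Section StanleyReisner.
Variables (k : fieldType) (V : finType).

Definition stanley_reisner_ideal (D : {set {set V}}) (p : polyring k V) : Prop :=
  exists c : {set V} -> polyring k V,
    p = \sum_(G : {set V} | G \notin D) c G * \prod_(v in G) var k v.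

Definition graded_piece (a : 'X_{1..#|V|}) (p : polyring k V) : Prop :=
  exists c : k, p = c *: 'X_[a].

(* The image of the subspace W in M / J has a basis with d elements. *)
Definition has_dim_mod (M : lmodType k) (W J : M -> Prop) (d : nat) : Prop :=
  exists b : 'I_d -> M,
    [/\ forall i, W (b i),
        forall c : 'I_d -> k, J (\sum_i c i *: b i) -> forall i, c i = 0
      & forall w, W w -> exists c : 'I_d -> k, J (w - \sum_i c i *: b i)].

Definition is_hilbert_function (J : polyring k V -> Prop)
    (h : 'X_{1..#|V|} -> nat) : Prop :=
  forall a, has_dim_mod (graded_piece a) J (h a).

(* Cauchy product in Z[[t_v : v in V]], a power series being given by its
   coefficients. *)
Definition series_mul (f g : 'X_{1..#|V|} -> int) (m : 'X_{1..#|V|}) : int :=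
  \sum_(c : 'X_{1..#|V| < (mdeg m).+1, (mdeg m).+1} | m == (c.1 + c.2)%MM)
    f c.1 * g c.2.

(* K is the numerator of the Hilbert series of k[V]/J over
   \prod_v (1 - t_v), i.e. Hilb(k[V]/J; t) * \prod_v (1 - t_v) = K. *)
Definition is_K_polynomial (J : polyring k V -> Prop)
    (K : polyring int V) : Prop :=
  exists2 h, is_hilbert_function J h &
    forall m, series_mul (fun a => (h a)%:Z)
                (fun a => (\prod_(v : V) (1 - var int v))@_a) m = K@_m.

End StanleyReisner.

Section Topology.
Local Open Scope classical_set_scope.

(* Barycentric coordinates; the support of a point must be a face. *)
Definition realization (R : realType) (V : finType) (D : {set {set V}}) :
    set 'rV[R]_#|V| :=
  [set p | [/\ forall i, 0 <= p ord0 i, \sum_i p ord0 i = 1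
             & finset (fun v => p ord0 (enum_rank v) != 0) \in D]].

Definition unit_ball (R : realType) (d : nat) : set 'rV[R]_d :=
  [set p | \sum_i p ord0 i ^+ 2 <= 1].

(* The (d-1)-dimensional sphere; it is empty for d = 0. *)
Definition unit_sphere (R : realType) (d : nat) : set 'rV[R]_d :=
  [set p | \sum_i p ord0 i ^+ 2 = 1].

Arguments realization R {V} D.
Arguments unit_ball R d : clear implicits.
Arguments unit_sphere R d : clear implicits.

Definition homeomorphic (S T : topologicalType) (A : set S) (B : set T) : Prop :=
  exists (f : S -> T) (g : T -> S),
    [/\ {within A, continuous f}, {within B, continuous g},
        forall x, A x -> B (f x), forall y, B y -> A (g y)
      & (forall x, A x -> g (f x) = x) /\ (forall y, B y -> f (g y) = y)].

Definition is_ball_or_sphere (R : realType) (V : finType)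
    (D : {set {set V}}) : Prop :=
  (exists d, homeomorphic (realization R D) (unit_ball R d)) \/
  (exists d, homeomorphic (realization R D) (unit_sphere R d)).

End Topology.

Section Tableaux.
Variables X Y : finType.
Implicit Types (f : {ffun X -> Y}) (F E : {set X * Y}) (T : {set {ffun X -> Y}}).

Definition graph f : {set X * Y} := [set (x, f x) | x : X].

Definition entries F (x : X) : {set Y} := [set y | (x, y) \in F].

(* The ground set {E \ {(x,y)} : (x,y) in E}. *)
Definition vertex E : finType :=
  {v : {set X * Y} | v \in [set E :\ e | e in E]}.

Definition tableau_complex T E : {set {set vertex E}} :=
  [set [set v : vertex E | val v \in [set E :\ e | e in E :\: F]]
     | F in [set F : {set X * Y} | (F \subset E)
                                     && [exists f in T, graph f \subset F]]].

(* The variable t_{v_{(x,y)}}, with the dummy value 0 when (x,y) is not in E. *)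
Definition tvar E (e : X * Y) : polyring int (vertex E) :=
  if insub (E :\ e) is Some v then var int (v : vertex E) else 0.

End Tableaux.

(* Main.v *)
From HB Require Import structures.
Require Import Defs.
From mathcomp Require Import all_boot all_order all_algebra.
From mathcomp Require Import mpoly.
From mathcomp Require Import classical_sets reals topology boolp normedtype sequences.
From mathcomp Require Import ring lra zify.
(* Repeated because [classical_sets] shadows [set0], [subsetP], ... *)
From mathcomp Require Import all_boot all_order all_algebra.

(** Expanding the Hilbert series face by face and substituting [u = 1 - t], the
    coefficient of [\prod_(v in F) u_v] in the K-polynomial is the alternating
    sum [link_euler] of the faces containing the complement of [F].  If every
    tableau in [F] lies in [T] this sum factors over the rows of [F] and is the
    sign of the theorem; if no tableau in [F] lies in [T] it is empty.

    In the mixed case the face [s] complementary to [F] has to be shown to lie on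
    the boundary of the ball.  Call a space locally null at [p] if small punctured
    neighbourhoods of [p] are contractible inside larger ones.  The ball is
    locally null at its boundary points (they are extreme), while its interior
    points, and likewise the points of a sphere, all behave alike.  A locally
    null point of a complex has a contractible link of directions, hence its
    support has zero alternating sum; so points inside a facet are not locally
    null.  Two tableaux of [F] that differ in one entry, one in [T] and one not,
    give a face above [s] lying in a single facet, at whose points the complex is
    locally null.  Therefore these points, and by closedness those of [s], are on
    the boundary of the ball, so that the alternating sum at [s] vanishes.

    That contractible complexes have vanishing alternating sum is proved with
    mod 2 chains: a fine barycentric subdivision, labelled by the largest
    barycentric coordinate, pushes forward to the identity (Sperner), and moving
    the labels along the contraction in small steps gives a chain contraction. *)

Set Implicit Arguments.
Unset Strict Implicit.
Unset Printing Implicit Defensive.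

Import GRing.Theory Num.Theory Order.TTheory.
Import numFieldTopology.Exports numFieldNormedType.Exports.

Local Open Scope ring_scope.

(** * Chains modulo 2 *)

(** The empty set is an admissible simplex, so the chain complex is augmented. The marker [^o] turns
    the field into a module over itself. *)
Notation chain V := {ffun {set V} -> ('F_2)^o}.

Lemma addrr_F2 (x : 'F_2) : x + x = 0.
Proof. by rewrite -mulr2n -mulr_natl -[2]/(1+1) (_ : 1+1 = 0 :> 'F_2) ?mul0r //; apply/val_inj. Qed.

Lemma addcc (I : finType) (c : {ffun I -> ('F_2)^o}) : c + c = 0.
Proof. by apply/ffunP=> i; rewrite !ffunE; exact: addrr_F2. Qed.

Lemma F2_neq0 (x : 'F_2) : x != 0 -> x = 1.
Proof. by case: x => [[|[|n]]] // h _; apply/val_inj. Qed.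

Section Chains.
Variable V : finType.
Implicit Types (A B : {set V}) (c d : chain V).

Definition simplex A : chain V := [ffun B => (A == B)%:R].

(** A simplex that already contains [w] is sent to zero. *)
Definition cone (w : V) c : chain V :=
  [ffun B : {set V} => if w \in B then c (B :\ w) else 0].

(** Written by coefficients: the value at [B] collects the simplices with one more vertex. The usual
    form, deleting one vertex at a time, is [boundary_simplex]. *)
Definition boundary c : chain V :=
  [ffun B : {set V} => \sum_(a | a \notin B) c (a |: B)].

Lemma cone_is_linear w : linear (cone w).
Proof.
by move=> x c d; apply/ffunP=> B; rewrite !ffunE; case: ifP; rewrite ?scaler0 ?addr0.
Qed.
HB.instance Definition _ w := GRing.isLinear.Build _ _ _ _ (cone w) (cone_is_linear w).

Lemma boundary_is_linear : linear boundary.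
Proof.
move=> x c d; apply/ffunP=> B; rewrite !ffunE scaler_sumr -big_split /=.
by apply: eq_bigr => a _; rewrite !ffunE.
Qed.
HB.instance Definition _ := GRing.isLinear.Build _ _ _ _ boundary boundary_is_linear.

(** The usual cone formula. Modulo 2 it holds for every chain, even one with simplices through
    [w]. *)
Lemma boundary_cone w c : boundary (cone w c) = c + cone w (boundary c).
Proof.
apply/ffunP=> B; rewrite !ffunE; case: ifP => wB; last first.
  rewrite addr0 (bigD1 w) ?wB //= ffunE setU11 setU1K ?wB // big1 ?addr0 //.
  by move=> a /andP[aB aw]; rewrite ffunE !inE wB eq_sym (negbTE aw).
(* On the right, the summand at [w] is [c B] again, and the two copies cancel modulo 2. *)
rewrite [in RHS](bigD1 w) ?setD11 //= setD1K // addrA [c B + _]addrr_F2 add0r.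
apply: eq_big => [a|a aB]; first by rewrite !inE; case: eqP => [->|]; rewrite ?wB ?andbT.
rewrite ffunE !inE wB orbT; congr (c _); apply/setP=> b; rewrite !inE.
have aw : a != w by apply: contraNneq aB => ->.
by case: (b =P a) => [->|] //=; rewrite aw.
Qed.

Lemma cone_simplex w A : w \notin A -> cone w (simplex A) = simplex (w |: A).
Proof.
move=> wA; apply/ffunP=> B; rewrite !ffunE.
case: ifP => wB; last by case: eqP => // AB; rewrite -AB setU11 in wB.
congr (_%:R); congr nat_of_bool; apply/eqP/eqP => [->|<-]; first by rewrite setD1K.
by rewrite setU1K.
Qed.

Lemma boundary_simplexE A B :
  boundary (simplex A) B = ((B \subset A) && (#|A| == #|B|.+1))%:R.
Proof.
rewrite ffunE; case: andP => [[BA /eqP cA]|nBA]; last first.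
  rewrite big1 // => a aB; rewrite ffunE; case: eqP => // AE; case: nBA.
  by rewrite AE subsetUr cardsU1 aB add1n eqxx.
have /cards1P[a aE] : #|A :\: B| == 1%N.
  by rewrite cardsD (setIidPr BA) cA subSnn.
have aA : a \in A :\: B by rewrite aE set11.
have AE : A = a |: B.
  apply/eqP; rewrite eq_sym eqEcard; rewrite cardsU1 cA; move: aA; rewrite inE => /andP[-> aA].
  by rewrite add1n leqnn andbT; apply/subsetP=> b; rewrite !inE => /orP[/eqP->|/(subsetP BA)].
move: aA; rewrite inE => /andP[aB aA].
rewrite (bigD1 a) //= ffunE AE eqxx big1 ?addr0 // => b /andP[bB ba].
rewrite ffunE; case: eqP => // /setP /(_ b); rewrite !inE eqxx (negbTE ba) /=.
by rewrite (negbTE bB).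
Qed.

Lemma boundary_simplex A : boundary (simplex A) = \sum_(a in A) simplex (A :\ a).
Proof.
apply/ffunP=> B; rewrite ffunE sum_ffunE.
rewrite [LHS]big_mkcond [RHS]big_mkcond /=; apply: eq_bigr => a _; rewrite !ffunE.
case: (boolP (a \in B)) => aB /=.
  case: ifP => // aA; case: eqP => // AB.
  by rewrite -AB setD11 in aB.
case: ifP => aA.
  congr (_%:R); congr nat_of_bool; apply/eqP/eqP => [->|<-]; first by rewrite setU1K.
  by rewrite setD1K.
by case: eqP => // AB; rewrite AB setU11 in aA.
Qed.

Lemma chain_sum c : c = \sum_A c A *: simplex A.
Proof.
apply/ffunP=> B; rewrite sum_ffunE (bigD1 B) //= big1 => [|A AB].
  by rewrite addr0 !ffunE eqxx -[RHS]/(_ * _) mulr1.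
by rewrite !ffunE (negbTE AB) scaler0.
Qed.

(** Every nonempty simplex is a cone [w * A'], and two uses of [boundary_cone] reduce the claim to
    [A']. *)
Lemma boundaryK c : boundary (boundary c) = 0.
Proof.
have dd A : boundary (boundary (simplex A)) = 0.
  elim: {A}#|A| {-2}A (erefl #|A|) => [A /cards0_eq->|n IH A cA].
    by rewrite boundary_simplex big_set0 linear0.
  have [a aA] : exists a, a \in A by apply/card_gt0P; rewrite cA.
  rewrite -(setD1K aA) -cone_simplex ?setD11 // boundary_cone linearD /= boundary_cone.
  rewrite IH ?linear0 ?addr0 ?addcc //.
  by move: cA; rewrite (cardsD1 a) aA add1n => -[].
by rewrite (chain_sum c) !linear_sum big1 //= => A _; rewrite !linearZ /= dd scaler0.
Qed.

Definition carried (P : {set V} -> Prop) c := forall B, c B != 0 -> P B.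

Lemma carried_sum P (I : finType) (Q : pred I) (f : I -> chain V) :
  (forall i, Q i -> carried P (f i)) -> carried P (\sum_(i | Q i) f i).
Proof.
move=> h B; rewrite sum_ffunE; case: (boolP [exists i, Q i && (f i B != 0)]).
  by move=> /existsP[i /andP[Qi fi]] _; apply: (h i).
rewrite negb_exists => /forallP h'; rewrite big1 ?eqxx // => i Qi.
by apply/eqP; move: (h' i); rewrite Qi /= negbK.
Qed.

Lemma carriedD P c d : carried P c -> carried P d -> carried P (c + d).
Proof.
move=> hc hd B; rewrite ffunE; case: (boolP (c B == 0)) => [/eqP->|/hc//].
by rewrite add0r => /hd.
Qed.

Lemma carriedZ P x c : carried P c -> carried P (x *: c).
Proof.
by move=> hc B; rewrite ffunE; case: (boolP (c B == 0)) => [/eqP->|/hc//]; rewrite scaler0 eqxx.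
Qed.

Lemma carried0 P : carried P 0.
Proof. by move=> B; rewrite ffunE eqxx. Qed.

Lemma carried_simplex (P : {set V} -> Prop) A : P A -> carried P (simplex A).
Proof. by move=> PA B; rewrite ffunE; have [<-|] := eqVneq A B; rewrite //= eqxx. Qed.

Lemma carriedS (P Q : {set V} -> Prop) c : (forall A, P A -> Q A) -> carried P c -> carried Q c.
Proof. by move=> h hc B /hc/h. Qed.

Lemma carried_cone (P Q : {set V} -> Prop) w c :
  (forall A, w \notin A -> P A -> Q (w |: A)) -> carried P c -> carried Q (cone w c).
Proof.
move=> h hc B; rewrite ffunE; case: ifP => [wB /hc|]; last by rewrite eqxx.
by move/h; rewrite setD11 setD1K //; apply.
Qed.

End Chains.

Definition lin (W V : finType) (g : {set W} -> chain V) (c : chain W) : chain V :=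
  \sum_A c A *: g A.

Section Lin.
Variables W V : finType.
Implicit Types (g f : {set W} -> chain V).

Lemma lin_is_linear g : linear (lin g).
Proof.
move=> x c d; rewrite /lin scaler_sumr -big_split /=; apply: eq_bigr => A _.
by rewrite !ffunE scalerDl scalerA.
Qed.
HB.instance Definition _ g := GRing.isLinear.Build _ _ _ _ (lin g) (lin_is_linear g).

Lemma lin_simplex g A : lin g (simplex A) = g A.
Proof.
rewrite /lin (bigD1 A) //= big1 => [|B BA]; first by rewrite !ffunE eqxx scale1r addr0.
by rewrite ffunE eq_sym (negbTE BA) scale0r.
Qed.

Lemma lin_eq (F G : {linear chain W -> chain V}) (c : chain W) :
  (forall A, c A != 0 -> F (simplex A) = G (simplex A)) -> F c = G c.
Proof.
move=> h; rewrite (chain_sum c) !linear_sum /=; apply: eq_bigr => A _; rewrite !linearZ /=.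
case: (boolP (c A == 0)) => [/eqP->|/h->//].
by rewrite !scale0r.
Qed.

Lemma carried_lin (P : {set W} -> Prop) (Q : {set V} -> Prop) g c :
  (forall A, P A -> carried Q (g A)) -> carried P c -> carried Q (lin g c).
Proof.
move=> h hc; apply: carried_sum => A _.
case: (boolP (c A == 0)) => [/eqP->|/hc PA]; first by rewrite scale0r; apply: carried0.
by apply: carriedZ; apply: h.
Qed.

End Lin.

(** * Simplicial maps on chains and chain homotopies between them *)

Section Push.
Variables W V : finType.
Implicit Types (phi psi : W -> V) (A : {set W}).

(** The chain map induced by a map of vertices: a simplex on which [phi] is not injective becomes
    degenerate and is sent to zero. *)
Definition push phi A : chain V :=
  if #|phi @: A| == #|A| then simplex (phi @: A) else 0.

Lemma push0 phi : push phi set0 = simplex set0.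
Proof. by rewrite /push imset0 !cards0. Qed.

(** When [phi w] is already a label of [A] both sides vanish, the left one as degenerate and the
    right one by the convention in [cone]. This allows induction on simplices by coning. *)
Lemma pushU1 phi w A : w \notin A -> push phi (w |: A) = cone (phi w) (push phi A).
Proof.
move=> wA; rewrite /push imsetU1 !cardsU1 wA add1n; case: (boolP (phi w \in _)) => pw.
  rewrite add0n ltn_eqF ?ltnS ?leq_imset_card //; case: ifP; rewrite ?linear0 // => _.
  apply/ffunP=> B; rewrite !ffunE; case: ifP => // _; case: eqP => // E.
  by rewrite E setD11 in pw.
by rewrite add1n eqSS; case: ifP; rewrite ?linear0 // cone_simplex.
Qed.

Lemma lin_push_cone phi w (c : chain W) : (forall B : {set W}, w \in B -> c B = 0) ->
  lin (push phi) (cone w c) = cone (phi w) (lin (push phi) c).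
Proof.
move=> h.
apply: (@lin_eq _ _ (lin (push phi) \o cone w) (cone (phi w) \o lin (push phi))) => A cA /=.
have wA : w \notin A by apply: contra_neqN cA; apply: h.
by rewrite cone_simplex // !lin_simplex pushU1.
Qed.

Lemma boundary_simplex_off w (A B : {set W}) : w \notin A -> w \in B -> boundary (simplex A) B = 0.
Proof.
move=> wA wB; rewrite boundary_simplexE; case: subsetP => //= /(_ w wB).
by rewrite (negbTE wA).
Qed.

Lemma boundary_push phi c : boundary (lin (push phi) c) = lin (push phi) (boundary c).
Proof.
apply: (@lin_eq _ _ (@boundary V \o lin (push phi)) (lin (push phi) \o @boundary W)) => A _ /=.
rewrite lin_simplex.
elim: {A}#|A| {-2}A (erefl #|A|) => [A /cards0_eq->|n IH A cA].
  by rewrite push0 !boundary_simplex !big_set0 linear0.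
have [a aA] : exists a, a \in A by apply/card_gt0P; rewrite cA.
rewrite -(setD1K aA) -cone_simplex ?setD11 // pushU1 ?setD11 // !boundary_cone linearD /=.
rewrite lin_simplex IH; last by move: cA; rewrite (cardsD1 a) aA add1n => -[].
by rewrite lin_push_cone // => B aB; apply: boundary_simplex_off aB; rewrite setD11.
Qed.

(** A chain homotopy with control of supports: simplices satisfying [M] are sent to chains in [L].
    The homotopy identity itself is asked for all chains, and signs are absent modulo 2. *)
Definition homotopic (L : {set V} -> Prop) (M : {set W} -> Prop) (f g : {set W} -> chain V) :=
  exists2 D : {set W} -> chain V,
    forall c, boundary (lin D c) + lin D (boundary c) = lin f c + lin g c
  & forall A, M A -> carried L (D A).

Lemma homotopic_refl L M f : homotopic L M f f.
Proof.
exists (fun=> 0) => [c|A _]; last exact: carried0.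
have lin0 (d : chain W) : lin (fun=> 0 : chain V) d = 0.
  by apply: big1 => A _; rewrite scaler0.
by rewrite addcc !lin0 linear0 addr0.
Qed.

Lemma linDf (f g : {set W} -> chain V) c : lin (fun A => f A + g A) c = lin f c + lin g c.
Proof. by rewrite /lin -big_split; apply: eq_bigr => A _; rewrite scalerDr. Qed.

Lemma homotopic_eqr L M f g g' : g =1 g' -> homotopic L M f g -> homotopic L M f g'.
Proof.
move=> gg' [D hD sD]; exists D => // c; rewrite hD.
suff -> : lin g c = lin g' c by [].
by apply: eq_bigr => A _; rewrite gg'.
Qed.

Lemma homotopic_trans L M f g h :
  homotopic L M f g -> homotopic L M g h -> homotopic L M f h.
Proof.
move=> [D hD sD] [D' hD' sD']; exists (fun A => D A + D' A) => [c|A MA]; last first.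
  by apply: carriedD; [apply: sD|apply: sD'].
rewrite !linDf linearD /= addrACA hD hD' addrA -[_ + _ + lin g c]addrA addcc.
by rewrite addr0.
Qed.

(** Only the label of [w] moves, from [phi w] to [u]. The prism over a simplex [w * A'] is then the
    single join of [phi w], [u] and the image of [A']; a simplex without [w] needs no prism. *)
Lemma homotopic_step phi w u (L : {set V} -> Prop) (M : {set W} -> Prop) :
  let phi' x := if x == w then u else phi x in
  (forall A B : {set V}, L A -> B \subset A -> L B) ->
  (forall A, M A -> L (phi @: A :|: phi' @: A)) ->
  homotopic L M (push phi) (push phi').
Proof.
move=> phi' Ldown hM.
have phi'E A : w \notin A -> push phi' A = push phi A.
  move=> wA; rewrite /push (_ : phi' @: A = phi @: A) //.
  by apply: eq_in_imset => x xA; rewrite /phi'; case: eqP => // xw; rewrite -xw xA in wA.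
pose D A := if w \in A then cone (phi w) (cone u (push phi (A :\ w))) else 0.
exists D => [c|A MA].
  apply: (@lin_eq _ _ ((@boundary V \o lin D) \+ (lin D \o @boundary W))
            (lin (push phi) \+ lin (push phi'))) => A _ /=.
  rewrite !lin_simplex {1}/D; case: (boolP (w \in A)) => wA; last first.
    rewrite linear0 add0r phi'E // addcc /lin big1 // => B _; rewrite /D.
    case: (boolP (w \in B)) => wB; last by rewrite scaler0.
    by rewrite (boundary_simplex_off wA wB) scale0r.
  have [A' AE wA'] : exists2 A', A = w |: A' & w \notin A'.
    by exists (A :\ w); rewrite ?setD1K ?setD11.
  have phiw : phi' w = u by rewrite /phi' eqxx.
  rewrite AE setU1K // !pushU1 // phi'E // phiw !boundary_cone.
  rewrite -(cone_simplex wA') boundary_cone [lin D (_ + _)]linearD /= lin_simplex.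
  rewrite {1}/D (negbTE wA') add0r.
  have -> : lin D (cone w (boundary (simplex A'))) =
            cone (phi w) (cone u (boundary (push phi A'))).
    rewrite -[in RHS](lin_simplex (push phi) A') boundary_push.
    apply: (@lin_eq _ _ (lin D \o cone w) (cone (phi w) \o (cone u \o lin (push phi)))) => B cB /=.
    have wB : w \notin B by apply: contra_neqN cB => wB; rewrite (boundary_simplex_off wA').
    by rewrite cone_simplex // !lin_simplex /D setU11 setU1K.
  rewrite [cone _ (_ + _)]linearD /=; set z := cone _ (cone _ _).
  by rewrite addrA -(addrA _ z z) (addcc z) addr0 addrC.
rewrite /D; case: ifP => wA; last exact: carried0.
apply: (@carriedS _ (fun B => B \subset phi @: A :|: phi' @: A)) => [B|].
  by apply: Ldown; apply: hM.
have cw v : v \in phi @: A :|: phi' @: A -> forall B : {set V}, v \notin B ->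
    B \subset phi @: A :|: phi' @: A -> v |: B \subset phi @: A :|: phi' @: A.
  by move=> vA B _ BA; rewrite subUset sub1set vA.
apply: (carried_cone (cw _ _)); first by rewrite inE imset_f.
apply: (carried_cone (cw _ _)).
  by rewrite inE; apply/orP; right; apply/imsetP; exists w; rewrite // /phi' eqxx.
rewrite /push; case: ifP => _; last exact: carried0.
apply: carried_simplex; apply: (subset_trans _ (subsetUl _ _)).
by apply: imsetS; apply: subD1set.
Qed.

(** Labels are changed one vertex at a time. All intermediate images of [A] stay inside the union of
    its two extreme images, which lies in [L]. *)
Lemma homotopic_contiguous phi psi (L : {set V} -> Prop) (M : {set W} -> Prop) :
  (forall A B : {set V}, L A -> B \subset A -> L B) ->
  (forall A, M A -> L (phi @: A :|: psi @: A)) ->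
  homotopic L M (push phi) (push psi).
Proof.
move=> Ldown hM.
pose mix (s : seq W) x := if x \in s then psi x else phi x.
have hmix s : homotopic L M (push phi) (push (mix s)).
  elim: s => [|w s IH].
    have -> : push (mix [::]) = push phi by [].
    exact: homotopic_refl.
  apply: (homotopic_trans IH).
  have := @homotopic_step (mix s) w (psi w) L M Ldown.
  set phi' := fun x => _; rewrite /= => /(_ _) H.
  have E A : phi' @: A = mix (w :: s) @: A.
    by apply: eq_imset => x; rewrite /phi' /mix inE; case: eqP => [->|].
  have {H} : homotopic L M (push (mix s)) (push phi').
    apply: H => A /hM LA; apply: (Ldown _ _ LA); rewrite subUset.
    by rewrite E; apply/andP; split; apply/subsetP=> _ /imsetP[x xA ->];
       rewrite inE /mix; case: ifP => _; rewrite ?[X in X || _]imset_f ?[X in _ || X]imset_f ?orbT.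
  have pE A : push phi' A = push (mix (w :: s)) A by rewrite /push E.
  exact: homotopic_eqr.
apply: homotopic_eqr (hmix (enum W)) => A; rewrite /push.
by rewrite (_ : mix (enum W) @: A = psi @: A) //; apply: eq_imset => x; rewrite /mix mem_enum.
Qed.

Lemma push_const phi v A : (forall x, phi x = v) ->
  push phi A = if #|A| == 0%N then simplex set0 else if #|A| == 1%N then simplex [set v] else 0.
Proof.
move=> hv; case: (boolP (A == set0)) => [/eqP->|A0]; first by rewrite cards0 push0.
have [a aA] := set0Pn _ A0.
have E : phi @: A = [set v].
  apply/setP=> x; rewrite inE; apply/imsetP/eqP => [[y _ ->]|->]; first exact: hv.
  by exists a.
by rewrite cards_eq0 (negbTE A0) /push E cards1 eq_sym.
Qed.

End Push.

(** * Alternating sums of complexes with a chain contraction *)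

(** The matrices [a] and [b] are the differentials of a two-periodic complex, contracted by the
    other four. The contraction bounds [m] and [n] by the sum of the ranks of [a] and [b], while
    [ab = 0] and [ba = 0] bound that sum by [n] and [m]. *)
Lemma acyclic_dim_eq (F : fieldType) m n (a : 'M[F]_(m, n)) (b : 'M[F]_(n, m))
    (d1 : 'M[F]_(m, n)) (d2 : 'M[F]_(n, m)) (e1 : 'M[F]_(n, m)) (e2 : 'M[F]_(m, n)) :
  1%:M = d1 *m b + a *m d2 -> 1%:M = e1 *m a + b *m e2 ->
  a *m b = 0 -> b *m a = 0 -> m = n.
Proof.
move=> h1 h2 ab ba; apply/eqP; rewrite eqn_leq; apply/andP; split.
  apply: leq_trans (mulmx0_rank_max ab).
  rewrite -[X in (X <= _)%N](mxrank1 F) h1 addnC; apply: (leq_trans (mxrank_add _ _)).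
  by apply: leq_add; [apply: mxrankM_maxr|apply: mxrankM_maxl].
apply: leq_trans (mulmx0_rank_max ba).
rewrite -[X in (X <= _)%N](mxrank1 F) h2 addnC; apply: (leq_trans (mxrank_add _ _)).
by apply: leq_add; [apply: mxrankM_maxr|apply: mxrankM_maxl].
Qed.

Section Euler.
Variables (V : finType) (L : {set {set V}}).
Hypothesis Ldown : forall A B : {set V}, A \in L -> B \subset A -> B \in L.

Let par b := [set A in L | odd #|A| == b].

Lemma sum_par b (f : {set V} -> 'F_2) :
  (forall A, f A != 0 -> (A \in L) && (odd #|A| == b)) ->
  \sum_(j < #|par b|) f (enum_val j) = \sum_A f A.
Proof.
move=> h; rewrite -(big_enum_val f) /= [RHS](bigID (mem (par b))) /= [X in _ + X]big1 ?addr0 //.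
by move=> A; rewrite inE; apply: contraNeq => /h.
Qed.

(** Faces of even and of odd cardinality are the bases of the two halves of a complex over the field
    with two elements. The contraction [D] forces the halves to have equal dimension, so the signs
    cancel over the integers as well. *)
Lemma contraction_euler (D : {set V} -> chain V) :
  (forall A, A \in L -> carried (fun B => B \in L) (D A)) ->
  (forall A, A \in L -> simplex A = boundary (D A) + lin D (boundary (simplex A))) ->
  \sum_(A in L) (-1) ^+ #|A| = 0 :> int.
Proof.
move=> hD hid.
pose inc b : 'M['F_2]_(#|par b|, #|par (~~ b)|) :=
  \matrix_(i, j) boundary (simplex (enum_val i)) (enum_val j).
pose inc' b : 'M['F_2]_(#|par (~~ b)|, #|par b|) :=
  \matrix_(i, j) boundary (simplex (enum_val i)) (enum_val j).
pose dm b : 'M['F_2]_(#|par b|, #|par (~~ b)|) := \matrix_(i, j) D (enum_val i) (enum_val j).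
pose dm' b : 'M['F_2]_(#|par (~~ b)|, #|par b|) := \matrix_(i, j) D (enum_val i) (enum_val j).
have parP b (i : 'I_#|par b|) : (enum_val i \in L) * (odd #|enum_val i| = b).
  by have := enum_valP i; rewrite inE => /andP[-> /eqP ->].
have bdE c B : boundary c B = \sum_A c A * boundary (simplex A) B.
  rewrite {1}(chain_sum c) linear_sum sum_ffunE; apply: eq_bigr => A _.
  by rewrite linearZ /= ffunE.
have linE c B : lin D c B = \sum_A c A * D A B.
  by rewrite /lin sum_ffunE; apply: eq_bigr => A _; rewrite ffunE.
have bdodd A B : boundary (simplex A) B != 0 -> odd #|A| = ~~ odd #|B|.
  by rewrite boundary_simplexE; case: andP => [[_ /eqP->]|]; rewrite /= ?eqxx.
have bdsub A B : boundary (simplex A) B != 0 -> B \subset A.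
  by rewrite boundary_simplexE; case: andP => [[-> _]|]; rewrite /= ?eqxx.
have mul0 b : inc b *m inc' b = 0.
  apply/matrixP=> i j; rewrite !mxE.
  under eq_bigr => l _ do rewrite !mxE.
  rewrite (@sum_par (~~ b) (fun C => boundary (simplex (enum_val i)) C * boundary (simplex C) (enum_val j))).
    by rewrite -bdE boundaryK ffunE.
  move=> C; rewrite mulf_eq0 negb_or => /andP[/[dup] /bdodd oC /bdsub sC _].
  rewrite (Ldown (parP _ i).1 sC) /=.
  by move: oC; rewrite (parP _ i).2 => ->; rewrite negbK.
have id b : 1%:M = dm b *m inc' b + inc b *m dm' b.
  apply/matrixP=> i j; rewrite !mxE.
  under [X in _ = X + _]eq_bigr => l _ do rewrite !mxE.
  under [X in _ = _ + X]eq_bigr => l _ do rewrite !mxE.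
  rewrite (@sum_par (~~ b) (fun C => D (enum_val i) C * boundary (simplex C) (enum_val j))); last first.
    move=> C; rewrite mulf_eq0 negb_or => /andP[/(hD _ (parP _ i).1) -> /bdodd ->].
    by rewrite (parP _ j).2 eqxx.
  rewrite (@sum_par (~~ b) (fun C => boundary (simplex (enum_val i)) C * D C (enum_val j))); last first.
    move=> C; rewrite mulf_eq0 negb_or => /andP[/[dup] /bdodd oC /bdsub sC _].
    rewrite (Ldown (parP _ i).1 sC) /=.
    by move: oC; rewrite (parP _ i).2 => ->; rewrite negbK.
  rewrite -bdE -linE.
  have := congr1 (fun c : chain V => c (enum_val j)) (hid _ (parP _ i).1).
  rewrite /= [RHS]ffunE => <-; rewrite ffunE.
  by rewrite (inj_eq enum_val_inj).
have cE : #|par false| = #|par true|.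
  apply: (acyclic_dim_eq (id false) (id true) (mul0 false) (mul0 true)).
rewrite (bigID (fun A : {set V} => odd #|A|)) /=.
under eq_bigr => A /andP[_ oA] do rewrite -signr_odd oA expr1.
under [X in _ + X]eq_bigr => A /andP[_ /negbTE oA] do rewrite -signr_odd oA expr0.
rewrite !sumr_const.
have -> : #|[pred A in L | odd #|A|]| = #|par true|.
  by apply: eq_card => A; rewrite !inE eqb_id.
have -> : #|[pred A in L | ~~ odd #|A|]| = #|par false|.
  by apply: eq_card => A; rewrite !inE eqbF_neg.
by rewrite cE mulNrn addNr.
Qed.

End Euler.

Section Sperner.
Variables (V W : finType).

(** An algebraic form of Sperner's lemma. The push-forward of [s A] can only be a multiple of [A];
    by induction its boundary is that of [A], which is nonzero, so the multiple is 1. *)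
Lemma sperner_push (L : {set {set V}}) (s : {set V} -> chain W) (phi : W -> V) :
  (forall A B : {set V}, A \in L -> B \subset A -> B \in L) ->
  s set0 = simplex set0 ->
  (forall A, A \in L -> boundary (s A) = \sum_(a in A) s (A :\ a)) ->
  (forall A, A \in L -> carried (fun B => #|B| = #|A| /\ phi @: B \subset A) (s A)) ->
  forall A, A \in L -> lin (push phi) (s A) = simplex A.
Proof.
move=> Ldown s0 bds cs A.
elim: {A}#|A| {-2}A (erefl #|A|) => [A /cards0_eq-> _|n IH A cA AL].
  by rewrite s0 lin_simplex push0.
set c := lin _ _.
have hc : carried (fun B => B = A) c.
  apply: carried_lin (cs A AL) => B [cB sB]; rewrite /push; case: eqP => E; last exact: carried0.
  by apply: carried_simplex; apply/eqP; rewrite eqEcard sB E cB leqnn.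
have [a aA] : exists a, a \in A by apply/card_gt0P; rewrite cA.
have cE : c = c A *: simplex A.
  apply/ffunP=> B; rewrite !ffunE; case: eqP => [<-|AB].
    by rewrite -[RHS]/(_ * _) mulr1.
  rewrite scaler0; apply/eqP; apply: contraT => /hc BA; by rewrite BA in AB.
have bdc : boundary c = boundary (simplex A).
  rewrite boundary_push bds // linear_sum boundary_simplex; apply: eq_bigr => b bA /=.
  apply: IH; first by move: cA; rewrite (cardsD1 b) bA add1n => -[].
  by apply: Ldown AL _; apply: subD1set.
have ne0 : boundary (simplex A) != 0.
  apply/eqP=> /ffunP /(_ (A :\ a)); rewrite boundary_simplexE subD1set /=.
  by rewrite [#|A|](cardsD1 a) aA add1n eqxx ffunE.
have /F2_neq0 c1 : c A != 0.
  apply: contraNneq ne0 => c0; rewrite -bdc cE c0 scale0r linear0.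
  by [].
by rewrite cE c1 scale1r.
Qed.

End Sperner.

(** * Combinatorial barycentric subdivision *)

Section Subdivision.
Variable W : finType.
Implicit Types (A : {set W}).

(** The vertex [A] of the subdivision stands for the barycenter of the simplex [A], from which the
    subdivided faces are coned. The argument [n] is fuel, equal to the cardinality of [A] in
    [sd]. *)
Fixpoint sdn n A : chain {set W} :=
  if n is n'.+1 then cone A (\sum_(a in A) sdn n' (A :\ a)) else simplex set0.

Definition sd A := sdn #|A| A.

Lemma sd0 : sd set0 = simplex set0.
Proof. by rewrite /sd cards0. Qed.

Lemma sdS A : A != set0 -> sd A = cone A (\sum_(a in A) sd (A :\ a)).
Proof.
rewrite -card_gt0 /sd; case E : #|A| => [//|n] _ /=; congr (cone _ _).
by apply: eq_bigr => a aA; move: E; rewrite (cardsD1 a) aA add1n => -[->].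
Qed.

(** By the cone formula the error term is the cone over the boundary of the subdivided faces; by
    induction that boundary is the subdivision of a double boundary. *)
Lemma boundary_sd A : boundary (sd A) = \sum_(a in A) sd (A :\ a).
Proof.
elim: {A}#|A| {-2}A (erefl #|A|) => [A /cards0_eq->|n IH A cA].
  by rewrite sd0 boundary_simplex !big_set0.
rewrite sdS -?card_gt0 ?cA // boundary_cone [boundary (\sum_(a in A) _)]linear_sum /=.
suff -> : \sum_(a in A) boundary (sd (A :\ a)) = 0 by rewrite [cone A 0]linear0 addr0.
rewrite (eq_bigr (fun a => lin sd (boundary (simplex (A :\ a))))) => [|a aA].
  have -> : \sum_(a in A) lin sd (boundary (simplex (A :\ a))) = lin sd (boundary (boundary (simplex A))).
    by rewrite (boundary_simplex A) !linear_sum.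
  by rewrite boundaryK linear0.
rewrite IH; last by move: cA; rewrite (cardsD1 a) aA add1n => -[].
by rewrite boundary_simplex linear_sum; apply: eq_bigr => b _; rewrite /= lin_simplex.
Qed.

Lemma lin_sd_boundary c : boundary (lin sd c) = lin sd (boundary c).
Proof.
apply: (@lin_eq _ _ (@boundary _ \o lin sd) (lin sd \o @boundary W)) => A _ /=.
rewrite lin_simplex boundary_sd boundary_simplex linear_sum.
by apply: eq_bigr => a _; rewrite /= lin_simplex.
Qed.

(** A maximal chain of nonempty subsets of [A], that is, a top simplex of the barycentric
    subdivision. *)
Definition flag A (F : {set {set W}}) :=
  [/\ #|F| = #|A|, forall B, B \in F -> (B \subset A) && (B != set0)
    & forall B C, B \in F -> C \in F -> (B \subset C) || (C \subset B)].

Lemma carried_sd A : carried (flag A) (sd A).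
Proof.
elim: {A}#|A| {-2}A (erefl #|A|) => [A /cards0_eq->|n IH A cA].
  by rewrite sd0; apply: carried_simplex; split=> [|B|B C]; rewrite ?cards0 // inE.
have A0 : A != set0 by rewrite -card_gt0 cA.
rewrite sdS //; apply: (@carried_cone _ (fun F => exists2 a, a \in A & flag (A :\ a) F)).
  move=> F AF [a aA [cF sF tF]]; split=> [|B|B C].
  - by rewrite cardsU1 AF cF [in RHS](cardsD1 a) aA.
  - rewrite !inE => /orP[/eqP->|/sF/andP[sB ->]]; first by rewrite subxx.
    by rewrite andbT (subset_trans sB) ?subD1set.
  - have sA B' : B' \in F -> B' \subset A by move/sF/andP=> [h _]; rewrite (subset_trans h) ?subD1set.
    by rewrite !inE => /orP[/eqP->|BF] /orP[/eqP->|CF]; rewrite ?subxx ?sA ?orbT ?tF.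
apply: carried_sum => a aA; apply: (@carriedS _ (flag (A :\ a))); first by move=> F hF; exists a.
by apply: IH; move: cA; rewrite (cardsD1 a) aA add1n => -[].
Qed.

End Subdivision.

(** The labellings [phi 0], ..., [phi m] are successively contiguous, so the identity (subdivide,
    then push along [phi 0]) is chain homotopic to pushing along a constant map. The latter is
    null-homotopic in the augmented complex, and [contraction_euler] applies. *)
Lemma contiguous_contraction_euler (V W : finType) (L : {set {set V}})
    (s : {set V} -> chain W) (M : {set W} -> Prop) (phi : nat -> W -> V) (m : nat) (v0 : V) :
  (forall A B : {set V}, A \in L -> B \subset A -> B \in L) ->
  s set0 = simplex set0 ->
  (forall A, A \in L -> boundary (s A) = \sum_(a in A) s (A :\ a)) ->
  (forall A, A \in L -> carried (fun B => #|B| = #|A| /\ M B) (s A)) ->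
  (forall i B, (i < m)%N -> M B -> phi i @: B :|: phi i.+1 @: B \in L) ->
  (forall A, A \in L -> lin (push (phi 0%N)) (s A) = simplex A) ->
  (forall w, phi m w = v0) -> [set v0] \in L ->
  \sum_(A in L) (-1) ^+ #|A| = 0 :> int.
Proof.
move=> Ldown s0 bds cs hphi phi0 phim v0L.
have [D hD sD] : homotopic (fun A => A \in L) M (push (phi 0%N)) (push (phi m)).
  elim: m hphi {phim} => [|m IH] hphi; first exact: homotopic_refl.
  apply: (homotopic_trans (IH _)) => [i B im|]; first by apply: hphi; apply: ltnW.
  by apply: homotopic_contiguous => // A; apply: hphi.
(* [K] sends the empty simplex to the vertex [v0]; it is the null-homotopy of the constant map. *)
pose K (A : {set V}) : chain V := if A == set0 then simplex [set v0] else 0.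
apply: (@contraction_euler V L Ldown (fun A => lin D (s A) + K A)) => A AL.
  apply: carriedD; first by apply: carried_lin (cs A AL) => B [_]; apply: sD.
  rewrite /K; case: ifP => _; [exact: carried_simplex|exact: carried0].
rewrite linDf linearD /=.
have -> : lin (fun A => lin D (s A)) (boundary (simplex A)) = lin D (boundary (s A)).
  rewrite bds // boundary_simplex !linear_sum; apply: eq_bigr => a _ /=.
  by rewrite lin_simplex.
rewrite addrACA hD phi0 // -addrA -[LHS]addr0; congr (_ + _).
suff -> : lin (push (phi m)) (s A) = boundary (K A) + lin K (boundary (simplex A)) by rewrite addcc.
have [->|A0] := eqVneq A set0.
  rewrite s0 lin_simplex push0 /K eqxx !boundary_simplex big_set0 linear0 addr0 big_set1.
  by rewrite setDv.
rewrite {1}/K (negbTE A0) linear0 add0r boundary_simplex linear_sum /=.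
have [/eqP/cards1P[a AE]|A1] := eqVneq #|A| 1%N.
  rewrite AE big_set1 setDv lin_simplex /K eqxx -AE.
  (* For one vertex the pushed chain is a multiple of [[set v0]]. Such a chain is the cone over its
     own boundary, and this boundary is known. *)
  have -> : lin (push (phi m)) (s A) = cone v0 (boundary (lin (push (phi m)) (s A))).
    apply: (@lin_eq _ _ (lin (push (phi m)))
      (cone v0 \o (@boundary V \o lin (push (phi m))))) => B /(cs A AL)[cB _] /=.
    rewrite lin_simplex (push_const _ phim) cB AE cards1 /=.
    by rewrite boundary_simplex big_set1 setDv cone_simplex ?inE // setU0.
  rewrite boundary_push bds // AE big_set1 setDv s0 lin_simplex push0.
  by rewrite cone_simplex ?inE // setU0.
(* With at least two vertices both sides vanish: the constant map degenerates every simplex of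
   [s A], and no face of [A] of codimension one is empty. *)
rewrite [RHS]big1 => [|a aA].
  apply: big1 => B _; have [->|/(cs A AL)[cB _]] := eqVneq (s A B) 0; first by rewrite scale0r.
  by rewrite (push_const _ phim) cB cards_eq0 (negbTE A0) (negbTE A1) scaler0.
rewrite lin_simplex /K; case: eqP => // E; case/negP: A1.
by rewrite (cardsD1 a) aA E cards0.
Qed.

(** * Geometric subdivision *)

Definition bary (R : realType) (V : finType) (p : 'rV[R]_#|V|) (v : V) : R :=
  p ord0 (enum_rank v).

Section Subdivide.
Variables (R : realType) (V : finType).
Implicit Types (p q : 'rV[R]_#|V|) (A : {set V}).

Lemma sum_bary p : \sum_i p ord0 i = \sum_v bary p v.
Proof.
rewrite (reindex (@enum_rank V)) //.
by exists (@enum_val V predT) => x _; rewrite ?enum_rankK ?enum_valK.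
Qed.

Definition in_simplex A p :=
  [/\ forall v, 0 <= bary p v, \sum_v bary p v = 1 & forall v, v \notin A -> bary p v = 0].

Definition point_of (f : V -> R) : 'rV[R]_#|V| := \row_i f (enum_val i).

Lemma bary_point f v : bary (point_of f) v = f v.
Proof. by rewrite /bary mxE enum_rankK. Qed.

Lemma bary_inj p q : (forall v, bary p v = bary q v) -> p = q.
Proof.
move=> h; apply/rowP=> i; rewrite -(enum_valK i); exact: h.
Qed.

Definition avg (W : finType) (B : {set W}) (x : W -> R) := (\sum_(w in B) x w) / #|B|%:R.

(** The difference is the mean of [x w - x w'] over pairs in [B] times [C]. For each [w] the term
    with [w' = w] vanishes, which gives the factor [1 - 1/#|C|]: the classical estimate for the mesh
    of a barycentric subdivision. *)
Lemma avg_diff (W : finType) (B C : {set W}) (x : W -> R) d :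
  B != set0 -> B \subset C ->
  (forall w w', w \in C -> w' \in C -> `|x w - x w'| <= d) ->
  `|avg B x - avg C x| <= (1 - #|C|%:R^-1) * d.
Proof.
move=> B0 BC hd.
have b0 : (0 < #|B|%:R :> R) by rewrite ltr0n card_gt0.
have c0 : (0 < #|C|%:R :> R).
  by rewrite ltr0n (leq_trans _ (subset_leq_card BC)) ?card_gt0.
have -> : avg B x - avg C x = (\sum_(w in B) \sum_(w' in C) (x w - x w')) / (#|B|%:R * #|C|%:R).
  under eq_bigr => w wB do rewrite sumrB sumr_const -mulr_natr.
  rewrite sumrB sumr_const -mulr_suml -mulr_natr /avg.
  by field; rewrite !gt_eqF.
rewrite normrM normfV [`|_ * _|]gtr0_norm ?mulr_gt0 // ler_pdivrMr ?mulr_gt0 //.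
apply: (le_trans (ler_norm_sum _ _ _)).
apply: (@le_trans _ _ (\sum_(w in B) ((#|C|%:R - 1) * d))); last first.
  by rewrite sumr_const -mulr_natr le_eqVlt; apply/orP; left; apply/eqP; field; rewrite gt_eqF.
apply: ler_sum => w wB; have wC := subsetP BC _ wB.
apply: (le_trans (ler_norm_sum _ _ _)).
rewrite (bigD1 w) //= subrr normr0 add0r.
apply: (@le_trans _ _ (\sum_(i in C | i != w) d)).
  by apply: ler_sum => w' /andP[w'C _]; apply: hd.
rewrite sumr_const.
have -> : #|[pred i in C | i != w]| = #|C :\ w| by apply: eq_card => i; rewrite !inE andbC.
have := cardsD1 w C; rewrite wC => ->; by rewrite natrD addrC addKr mulr_natl.
Qed.

(** Existence of a geometric subdivision of the full simplex on [V] whose simplices have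
    coordinate-wise diameter at most [e]. The vertex type [W] is existential because it changes with
    every barycentric subdivision. *)
Definition subdivided (e : R) := exists (W : finType) (pos : W -> 'rV[R]_#|V|) (s : {set V} -> chain W),
  [/\ s set0 = simplex set0, forall A, boundary (s A) = \sum_(a in A) s (A :\ a)
    & forall A, carried (fun B => [/\ #|B| = #|A|, forall w, w \in B -> in_simplex A (pos w)
        & forall w w' v, w \in B -> w' \in B -> `|bary (pos w) v - bary (pos w') v| <= e]) (s A)].

Lemma subdivided_id : subdivided 1.
Proof.
exists V, (fun v => point_of (fun u => (u == v)%:R)), (@simplex V).
split=> // [A|A]; first exact: boundary_simplex.
apply: carried_simplex; split=> // [w wA|w w' v wA w'A].
  split=> [v||v vA]; rewrite ?bary_point ?ler0n //.
    by rewrite (bigD1 w) //= bary_point eqxx big1 ?addr0 // => v vw; rewrite bary_point (negbTE vw).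
  by case: eqP => // E; rewrite -E (negbTE vA) in wA.
by rewrite !bary_point; do 2!case: eqP => _; rewrite ?subrr ?subr0 ?sub0r ?normrN ?normr1 ?normr0.
Qed.

(** A nonempty set of old vertices is placed at its barycenter. Simplices have at most [#|V|]
    vertices, so [avg_diff] shrinks the mesh by a uniform factor. *)
Lemma subdivided_step e : subdivided e -> subdivided ((1 - #|V|%:R^-1) * e).
Proof.
move=> [W [pos [s [s0 bds cs]]]].
exists {set W}, (fun B => point_of (fun v => avg B (fun w => bary (pos w) v))), (fun A => lin (@sd W) (s A)).
split=> [|A|A].
- by rewrite s0 lin_simplex sd0.
- by rewrite lin_sd_boundary bds linear_sum.
apply: carried_lin (cs A) => B [cB sB dB] F /carried_sd [cF sF tF]; split.
- by rewrite cF cB.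
- move=> C /sF/andP[CB C0].
  have c0 : (#|C|%:R != 0 :> R) by rewrite pnatr_eq0 cards_eq0.
  split=> [v||v vA]; rewrite ?bary_point.
  + apply: divr_ge0 => //; apply: sumr_ge0 => w wC.
    by have [-> _ _] := sB w (subsetP CB _ wC).
  + under eq_bigr => v _ do rewrite bary_point.
    rewrite -mulr_suml exchange_big /=.
    under eq_bigr => w wC do [have [_ -> _] := sB w (subsetP CB _ wC)].
    by rewrite sumr_const divff.
  + rewrite /avg big1 ?mul0r // => w wC; have [_ _ h] := sB w (subsetP CB _ wC); exact: h.
- have main C C' v : C \in F -> C' \in F -> C \subset C' ->
    `|avg C (fun w => bary (pos w) v) - avg C' (fun w => bary (pos w) v)| <= (1 - #|V|%:R^-1) * e.
    move=> /sF/andP[CB C0] /sF/andP[C'B C'0] CC'.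
    have [w0 w0C] := set0Pn _ C'0.
    have e0 : 0 <= e by apply: le_trans (dB w0 w0 v _ _); rewrite ?(subsetP C'B).
    have V0 : (0 < #|V|)%N by rewrite (leq_trans _ (max_card (pred1 v))) ?card1.
    apply: (le_trans (@avg_diff W C C' _ e C0 CC' _)).
      by move=> w w' wC w'C; apply: dB; apply: (subsetP C'B).
    apply: ler_wpM2r => //; rewrite lerD2l lerN2 lef_pV2 ?posrE ?ltr0n ?card_gt0 //.
      by rewrite ler_nat (leq_trans (subset_leq_card C'B)) // cB max_card.
  move=> C C' v CF C'F; rewrite !bary_point.
  by case/orP: (tF _ _ CF C'F) => h; [|rewrite distrC]; apply: main.
Qed.

Lemma small_expr (q e : R) : 0 <= q < 1 -> 0 < e -> exists n, q ^+ n <= e.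
Proof.
move=> /andP[q0 q1] e0.
have := @cvg_expr R q; rewrite ger0_norm // => /(_ q1) /cvgrPdist_le /(_ e e0) [N _ /(_ N (leqnn N))].
by rewrite sub0r normrN normrX ger0_norm // => h; exists N.
Qed.

Lemma subdivided_fine e : 0 < e -> subdivided e.
Proof.
move=> e0.
(* For empty [V] the shrinking factor would be 1, since the inverse of 0 is 0; but then there are no
   coordinates to compare. *)
have [V0|V0] := posnP #|V|.
  have [W [pos [s [s0 bds cs]]]] := subdivided_id; exists W, pos, s; split=> // A B /cs[cB sB _].
  split=> // w w' v; have := max_card (pred1 v); rewrite card1 V0 //.
have q1 : 0 <= (1 - #|V|%:R^-1 : R) < 1.
  rewrite subr_ge0 invf_le1 ?ltr0n // ler1n V0 /= ltrBlDr ltrDl invr_gt0 ltr0n //.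
have [n hn] := small_expr q1 e0.
have [W [pos [s [s0 bds cs]]]] : subdivided ((1 - #|V|%:R^-1) ^+ n).
  elim: n {hn} => [|n IH]; first exact: subdivided_id.
  rewrite exprS; exact: subdivided_step.
exists W, pos, s; split=> // A B /cs[cB sB dB]; split=> // w w' v wB w'B.
by apply: le_trans (dB _ _ _ wB w'B) hn.
Qed.

End Subdivide.

(** * Continuity and compactness *)

Lemma finite_pos_lb (R : realDomainType) (I : finType) (P : pred I) (f : I -> R) :
  (forall i, P i -> 0 < f i) -> exists2 e, 0 < e & forall i, P i -> e <= f i.
Proof.
move=> h; exists (\big[Num.min/1]_(i | P i) f i).
  by apply: (big_ind (fun x => 0 < x)) => // x y x0 y0; rewrite lt_min x0.
by move=> i Pi; apply: bigmin_le_cond.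
Qed.

Section Continuity.
Variable R : realType.
Local Open Scope classical_set_scope.

(** Relative continuity in filter form, so that the limit rules for sums, products and inverses
    apply pointwise. *)
Definition cont_on (S T : topologicalType) (A : set S) (f : S -> T) :=
  forall x, A x -> f @ within A (nbhs x) --> f x.

Lemma cont_onP (S T : pseudoMetricType R) (A : set S) (f : S -> T) :
  cont_on A f <-> forall x, A x -> forall e : R, 0 < e -> exists2 d : R, 0 < d &
    forall y, A y -> ball x d y -> ball (f x) e (f y).
Proof.
split=> [h x Ax e e0|h x Ax].
  have : nbhs x [set y | A y -> ball (f x) e (f y)].
    exact: (proj1 (cvg_ballP _ _) (h x Ax)) e e0.
  move=> /nbhs_ballP[d d0 hd].
  by exists d => // y Ay /hd; apply.
apply/cvg_ballP => e e0; have [d d0 hd] := h x Ax e e0.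
suff : nbhs x [set y | A y -> ball (f x) e (f y)] by [].
by apply/nbhs_ballP; exists d => // y xy Ay; apply: hd.
Qed.

Lemma rV_ballP n (p q : 'rV[R]_n) (e : R) : 0 < e ->
  (ball p e q <-> forall i, `|p ord0 i - q ord0 i| < e).
Proof.
move=> e0; split=> [[_ h] i|h]; first exact: (h ord0 i).
by split=> // i j; rewrite ord1; apply: h.
Qed.

Lemma cont_onS (S T : topologicalType) (A B : set S) (f : S -> T) :
  A `<=` B -> cont_on B f -> cont_on A f.
Proof.
move=> AB h x Ax; apply: cvg_trans (h x (AB _ Ax)); apply: cvg_app.
exact: within_subset.
Qed.

Lemma cont_on_comp (S T U : pseudoMetricType R) (A : set S) (B : set T) (f : S -> T) (g : T -> U) :
  cont_on A f -> cont_on B g -> (forall x, A x -> B (f x)) -> cont_on A (fun x => g (f x)).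
Proof.
move=> /cont_onP hf /cont_onP hg AB; apply/cont_onP => x Ax e e0.
have [d d0 hd] := hg _ (AB _ Ax) e e0; have [d' d'0 hd'] := hf _ Ax d d0.
by exists d' => // y Ay xy; apply: hd; [apply: AB|apply: hd'].
Qed.

Lemma cont_on_pair (S T U : pseudoMetricType R) (A : set S) (f : S -> T) (g : S -> U) :
  cont_on A f -> cont_on A g -> cont_on A (fun x => (f x, g x)).
Proof. by move=> hf hg x Ax; apply: (cvg_pair (hf x Ax) (hg x Ax)). Qed.

Lemma cont_on_row (S : pseudoMetricType R) n (A : set S) (f : S -> 'rV[R]_n) :
  (forall i, cont_on A (fun x => f x ord0 i)) -> cont_on A f.
Proof.
move=> h; apply/cont_onP => x Ax e e0.
have hd i : exists d : R, 0 < d /\ forall y, A y -> ball x d y -> `|f x ord0 i - f y ord0 i| < e.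
  by have /cont_onP/(_ x Ax e e0)[d d0 hd] := h i; exists d.
have [d hd'] := choice hd.
have [d0 d00 d0le] := @finite_pos_lb _ 'I_n xpredT d (fun i _ => (hd' i).1).
exists d0 => // y Ay xy; apply/rV_ballP => // i; apply: (hd' i).2 => //.
by apply: le_ball xy; apply: d0le.
Qed.

Lemma cont_on_id (S : topologicalType) (A : set S) : cont_on A id.
Proof. by move=> x Ax; apply: cvg_within. Qed.

Lemma cont_on_cst (S T : topologicalType) (A : set S) (c : T) : cont_on A (fun=> c).
Proof. by move=> x Ax; apply: cvg_cst. Qed.

Lemma cont_on_coord (S : pseudoMetricType R) n (A : set S) (f : S -> 'rV[R]_n) i :
  cont_on A f -> cont_on A (fun x => f x ord0 i).
Proof.
move=> /cont_onP h; apply/cont_onP => x Ax e e0; have [d d0 hd] := h x Ax e e0.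
by exists d => // y Ay xy; have /rV_ballP := hd y Ay xy; apply.
Qed.

Lemma cont_on_fst (S T : pseudoMetricType R) (A : set (S * T)) : cont_on A fst.
Proof. by apply/cont_onP => x Ax e e0; exists e => // y Ay []. Qed.

Lemma cont_on_snd (S T : pseudoMetricType R) (A : set (S * T)) : cont_on A snd.
Proof. by apply/cont_onP => x Ax e e0; exists e => // y Ay []. Qed.

Section Arith.
Variables (S : pseudoMetricType R) (A : set S).
Implicit Types f g : S -> R.

Lemma cont_onD f g : cont_on A f -> cont_on A g -> cont_on A (fun x => f x + g x).
Proof. by move=> hf hg x Ax; apply: (cvgD (hf x Ax) (hg x Ax)). Qed.

Lemma cont_onN f : cont_on A f -> cont_on A (fun x => - f x).
Proof. by move=> hf x Ax; apply: (cvgN (hf x Ax)). Qed.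

Lemma cont_onB f g : cont_on A f -> cont_on A g -> cont_on A (fun x => f x - g x).
Proof. by move=> hf hg; apply: cont_onD => //; apply: cont_onN. Qed.

Lemma cont_onM f g : cont_on A f -> cont_on A g -> cont_on A (fun x => f x * g x).
Proof. by move=> hf hg x Ax; apply: (cvgM (hf x Ax) (hg x Ax)). Qed.

Lemma cont_onV f : cont_on A f -> (forall x, A x -> f x != 0) -> cont_on A (fun x => (f x)^-1).
Proof. by move=> hf h0 x Ax; apply: (cvgV (h0 x Ax) (hf x Ax)). Qed.

Lemma cont_on_min f g : cont_on A f -> cont_on A g -> cont_on A (fun x => Num.min (f x) (g x)).
Proof.
move=> /cont_onP hf /cont_onP hg; apply/cont_onP => x Ax e e0.
have [d d0 hd] := hf x Ax e e0; have [d' d'0 hd'] := hg x Ax e e0.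
exists (Num.min d d'); first by rewrite lt_min d0.
move=> y Ay xy.
have : `|f x - f y| < e by apply: hd => //; apply: le_ball xy; rewrite ge_min lexx.
have : `|g x - g y| < e by apply: hd' => //; apply: le_ball xy; rewrite ge_min lexx orbT.
rewrite -[ball _ _ _]/(is_true (`|_ - _| < e)) !ltr_norml => /andP[a1 a2] /andP[b1 b2].
by case: (ltP (f x)) => h1; case: (ltP (f y)) => h2; apply/andP; split; lra.
Qed.

Lemma cont_on_bigmin (I : Type) (r : seq I) (P : pred I) (F : I -> S -> R) c :
  (forall i, P i -> cont_on A (F i)) -> cont_on A (fun x => \big[Num.min/c]_(i <- r | P i) F i x).
Proof.
move=> h; elim: r => [|i r IH].
  by under eq_fun do rewrite big_nil; apply: cont_on_cst.
under eq_fun do rewrite big_cons.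
by case: (boolP (P i)) => // Pi; apply: cont_on_min => //; apply: h.
Qed.

Lemma cont_on_sum (I : Type) (r : seq I) (P : pred I) (F : I -> S -> R) :
  (forall i, P i -> cont_on A (F i)) -> cont_on A (fun x => \sum_(i <- r | P i) F i x).
Proof.
move=> h; elim: r => [|i r IH].
  by under eq_fun do rewrite big_nil; apply: cont_on_cst.
under eq_fun do rewrite big_cons.
by case: (boolP (P i)) => // Pi; apply: cont_onD => //; apply: h.
Qed.

End Arith.

(** The Heine-Cantor theorem, by the near-covering form of compactness with the radius [d] tending
    to 0 from the right. *)
Lemma compact_uniform (S T : pseudoMetricType R) (K : set S) (f : S -> T) :
  compact K -> cont_on K f -> forall e : R, 0 < e -> exists2 d : R, 0 < d &
    forall x y, K x -> K y -> ball x d y -> ball (f x) e (f y).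
Proof.
move=> /compact_near_coveringP cK /cont_onP hf e e0.
have := cK R (0 : R)^'+ (fun d x => forall y, K x -> K y -> ball x d y -> ball (f x) e (f y)) _.
case.
  move=> x Kx; have [d d0 hd] := hf x Kx (e / 2) ltac:(by rewrite divr_gt0).
  exists (ball x (d / 2), [set z | z < d / 2]); first split.
  - by apply/nbhs_ballP; exists (d / 2) => //=; rewrite divr_gt0.
  - by apply: nbhs_right_lt; rewrite divr_gt0.
  move=> [x' z] [/= xx' zd] y Kx' Ky x'y; apply: (@ball_splitr _ _ (f x)).
    by apply: hd => //; apply: le_ball xx'; lra.
  apply: hd => //; apply: (ball_split xx'); apply: le_ball x'y; exact: ltW.
move=> d /= d0 /(_ (d / 2)) h; exists (d / 2); first by rewrite divr_gt0.
move=> x y Kx Ky; apply: h => //=; last by rewrite divr_gt0.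
by rewrite sub0r normrN gtr0_norm; lra.
Qed.

End Continuity.

(** * Geometric realizations and their compactness *)

Section Realization.
Variables (R : realType) (V : finType).
Implicit Types (L : {set {set V}}) (p : 'rV[R]_#|V|).

Definition supp p : {set V} := [set v | bary p v != 0].

Lemma in_supp p v : (v \in supp p) = (bary p v != 0).
Proof. by rewrite inE. Qed.

Lemma realizationP L p : @realization R V L p <->
  [/\ forall v, 0 <= bary p v, \sum_v bary p v = 1 & supp p \in L].
Proof.
split=> [[h0 h1 h2]|[h0 h1 h2]]; split=> //.
- by move=> v; apply: h0.
- by rewrite -sum_bary.
- by move=> i; rewrite -(enum_valK i); apply: h0.
- by rewrite sum_bary.
Qed.

Lemma bary_le1 L p v : realization L p -> bary p v <= 1.
Proof.
move=> /realizationP[h0 <- _]; rewrite (bigD1 v) //= lerDl.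
by apply: sumr_ge0.
Qed.

Lemma ball_baryP p q (e : R) : 0 < e ->
  (ball p e q <-> forall v, `|bary p v - bary q v| < e).
Proof.
move=> e0; rewrite rV_ballP //; split=> h i; first exact: h.
by rewrite -(enum_valK i); apply: h.
Qed.

(** A coordinate that is nonzero at [p] stays nonzero at a distance below its absolute value, and
    there are finitely many coordinates. Supports can thus only grow near [p]. *)
Lemma supp_near p : exists2 e : R, 0 < e & forall q, ball p e q -> supp p \subset supp q.
Proof.
have [|e e0 he] := @finite_pos_lb R V (fun v => v \in supp p) (fun v => `|bary p v|).
  by move=> v; rewrite in_supp normr_gt0.
exists e => // q /(ball_baryP _ _ e0) h; apply/subsetP=> v vp; rewrite in_supp.
apply/eqP=> qv; have := h v; rewrite qv subr0 => /lt_le_trans /(_ (he v vp)).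
by rewrite ltxx.
Qed.

Local Open Scope classical_set_scope.

(** The realization sits in a cube, and it is closed because the support of a limit is contained in
    the support of nearby points, hence is a face. *)
Lemma compact_realization L : (forall A B : {set V}, A \in L -> B \subset A -> B \in L) ->
  compact (@realization R V L).
Proof.
move=> Ldown.
apply: (@subclosed_compact _ _ [set v : 'rV[R]_#|V| | forall i, `[0, 1] (v ord0 i)]).
- move=> p clp.
  have near_p (e : R) : 0 < e -> exists2 q, realization L q & ball p e q.
    by move=> e0; have [q [Lq pq]] := clp _ (nbhsx_ballx p e e0); exists q.
  apply/realizationP; split.
  + move=> v; rewrite leNgt; apply/negP=> pv.
    have e0 : 0 < - bary p v by lra.
    have [q /realizationP[/(_ v) q0 _ _] /(ball_baryP _ _ e0)/(_ v)] := near_p _ e0.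
    by rewrite ltr_norml => /andP[h1 h2]; lra.
  + apply/eqP; rewrite -subr_eq0 -normr_le0; apply/ler_addgt0Pr => e e0; rewrite add0r.
    (* The sum of [#|V|] errors stays below [e]; the added 1 keeps the denominator positive. *)
    have d0 : 0 < e / (#|V|%:R + 1) by rewrite divr_gt0 // ltr_wpDl.
    have [q /realizationP[_ q1 _] /(ball_baryP _ _ d0) h] := near_p _ d0.
    rewrite -q1 -sumrB; apply: (le_trans (ler_norm_sum _ _ _)).
    apply: (@le_trans _ _ (\sum_(v : V) (e / (#|V|%:R + 1)))).
      by apply: ler_sum => v _; apply/ltW/h.
    rewrite sumr_const -[_ *+ _]mulr_natl mulrCA ger_pMr // ler_pdivrMr ?mul1r ?lerDl //.
    by rewrite ltr_wpDl.
  + have [e e0 he] := supp_near p.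
    have [q /realizationP[_ _ Lq] /he] := near_p _ e0; exact: Ldown.
- by apply: (@rV_compact R #|V| (fun=> `[0, 1]%classic)) => i; apply: segment_compact.
- move=> p Lp i /=; rewrite in_itv /= -(enum_valK i).
  by have /realizationP[/(_ (enum_val i)) -> _ _] := Lp; apply: bary_le1 Lp.
Qed.

End Realization.

(** * Contractible complexes *)

Definition cylinder (R : realType) n (A : set 'rV[R]_n) : set (R * 'rV[R]_n) :=
  (fun z => 0 <= z.1 <= 1 /\ A z.2).

Lemma compact_cylinder (R : realType) n (A : set 'rV[R]_n) :
  compact A -> compact (cylinder A).
Proof.
move=> cA; have -> : cylinder A = (`[(0 : R), 1] `*` A)%classic.
  by apply/seteqP; split=> -[t x] [h Ax]; split=> //; move: h; rewrite /= in_itv.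
by apply: compact_setX => //; apply: segment_compact.
Qed.

Definition contractible (R : realType) n (A : set 'rV[R]_n) :=
  exists (H : R * 'rV[R]_n -> 'rV[R]_n) (c : 'rV[R]_n),
  [/\ A c, cont_on (cylinder A) H,
      forall t x, 0 <= t <= 1 -> A x -> A (H (t, x)),
      forall x, A x -> H (0, x) = x & forall x, A x -> H (1, x) = c].

Section Contractible.
Variables (R : realType) (V : finType) (L : {set {set V}}).
Hypothesis Ldown : forall A B : {set V}, A \in L -> B \subset A -> B \in L.
Implicit Types p q : 'rV[R]_#|V|.

(** A vertex with the largest barycentric coordinate; [v0] only shows that [V] is inhabited. *)
Definition label (v0 : V) p : V := [arg max_(v > v0) bary p v]%O.

(** The coordinates sum to 1, so the largest is at least their mean. *)
Lemma label_ge v0 p : realization L p -> #|V|%:R^-1 <= bary p (label v0 p).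
Proof.
move=> /realizationP[_ p1 _]; rewrite /label; case: Order.TotalTheory.arg_maxP => // v _ hv.
have V0 : (0 < #|V|)%N by rewrite (leq_trans _ (max_card (pred1 v0))) ?card1.
rewrite -[_^-1]mulr1 ler_pdivrMl ?ltr0n // mulr_natl -sumr_const -[X in X <= _]p1.
by apply: ler_sum => u _; apply: hv.
Qed.

Lemma label_supp v0 p : realization L p -> label v0 p \in supp p.
Proof.
move=> /(label_ge v0) h; rewrite in_supp gt_eqF //; apply: lt_le_trans h.
by rewrite invr_gt0 ltr0n (leq_trans _ (max_card (pred1 v0))) ?card1.
Qed.

Lemma contractible_euler : contractible (@realization R V L) ->
  \sum_(A in L) (-1) ^+ #|A| = 0 :> int.
Proof.
move=> [H [c [Lc cH HL H0 H1]]].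
have [v0 v0c] : exists v, v \in supp c.
  apply/set0Pn; apply/eqP => s0; have /realizationP[_ + _] := Lc.
  rewrite big1 => [/eqP|v _]; first by rewrite eq_sym oner_eq0.
  by apply/eqP; rewrite -[_ == _]negbK -in_supp s0 inE.
have V0 : (0 < #|V|)%N by rewrite (leq_trans _ (max_card (pred1 v0))) ?card1.
have N0 : 0 < #|V|%:R^-1 :> R by rewrite invr_gt0 ltr0n.
have cpt := compact_cylinder (@compact_realization R _ _ Ldown).
(* Within distance [d], the images under [H] differ by less than [1/#|V|], the lower bound for the
   coordinate of a label. A mesh of [d / 2] and time steps of length [1/m < d] stay within this
   range. *)
have [d d0 hd] := compact_uniform cpt cH N0.
have d20 : 0 < d / 2 by rewrite divr_gt0.
have [W [pos [s [s0 bds cs]]]] := @subdivided_fine R V _ d20.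
pose m := (Num.truncn (d^-1)).+1.
have m0 : 0 < m%:R :> R by rewrite ltr0n.
have md : m%:R^-1 < d.
  by rewrite -[d]invrK ltf_pV2 ?posrE ?invr_gt0 // truncnS_gt.
pose t i : R := i%:R / m%:R.
have t01 i : (i <= m)%N -> 0 <= t i <= 1.
  by move=> im; rewrite /t divr_ge0 ?ler0n //= ler_pdivrMr // mul1r ler_nat.
(* Vertices outside the realization get the final label at all times, so that [phi m] is constant on
   the whole of [W]. *)
pose phi i w := if `[< realization L (pos w) >] then label v0 (H (t i, pos w)) else label v0 c.
have phiE i w : realization L (pos w) -> phi i w = label v0 (H (t i, pos w)).
  by move=> h; rewrite /phi asboolT.
pose M (B : {set W}) := (forall w, w \in B -> realization L (pos w)) /\
  (forall w w' v, w \in B -> w' \in B -> `|bary (pos w) v - bary (pos w') v| <= d / 2).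
have posL A w : A \in L -> in_simplex A (pos w) -> realization L (pos w).
  move=> AL [h0 h1 h2]; apply/realizationP; split=> //; apply: Ldown AL _.
  by apply/subsetP=> v; rewrite in_supp; apply: contraNT => /h2 ->.
apply: (@contiguous_contraction_euler V W L s M phi m (label v0 c)) => //.
- move=> A AL B /cs[cB sB dB]; split=> //; split=> // w wB.
  by apply: posL AL _; apply: sB.
- move=> i B im [LB dB].
  have [->|/set0Pn[w0 w0B]] := eqVneq B set0.
    by rewrite !imset0 setU0; apply: Ldown (sub0set (supp c)); have /realizationP[] := Lc.
  (* All labels of [B] at both times have nonzero coordinate at the one point [H (t i, pos w0)].
     They therefore lie in its support, which is a face. *)
  have close j w : w \in B -> (j == i) || (j == i.+1) ->
      bary (H (t i, pos w0)) (phi j w) != 0.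
    move=> wB ji; have wL := LB _ wB; rewrite phiE //.
    have j01 : 0 <= t j <= 1 by apply: t01; case/orP: ji => /eqP->; [apply: ltnW|].
    have HLj := HL _ _ j01 wL.
    have : ball (H (t i, pos w0)) (#|V|%:R^-1) (H (t j, pos w)).
      apply: hd; [split=> /=|split=> /=|split=> /=].
      + by rewrite t01 // ltnW.
      + exact: LB.
      + exact: j01.
      + exact: wL.
      + rewrite -[ball _ _ _]/(is_true (`|_ - _| < d)) /t -mulrBl.
        case/orP: ji => /eqP->; first by rewrite subrr mul0r normr0.
        by rewrite -natr1 opprD addrA subrr add0r mulN1r normrN gtr0_norm ?invr_gt0.
      + apply/ball_baryP => // v; apply: le_lt_trans (dB _ _ v w0B wB) _; lra.
    move/ball_baryP => /(_ N0 (label v0 (H (t j, pos w)))).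
    have := label_ge v0 HLj; rewrite ltr_norml => h /andP[h' _]; rewrite gt_eqF //; lra.
  have /realizationP[_ _ hs] : realization L (H (t i, pos w0)).
    by apply: HL; [apply: t01; apply: ltnW|apply: LB].
  apply: Ldown hs _; apply/subsetP=> v; rewrite in_supp.
  by case/setUP=> /imsetP[w wB ->]; apply: close; rewrite ?eqxx ?orbT.
(* At time 0 the label of a point is a vertex of its own support: Sperner's condition. *)
- apply: sperner_push => // A AL B /cs[cB sB dB]; split=> //.
  apply/subsetP=> _ /imsetP[w wB ->].
  have sw := sB w wB; have wL := posL _ _ AL sw.
  rewrite phiE // /t mul0r H0 //; have := label_supp v0 wL; rewrite in_supp.
  by case: sw => _ _ h; apply: contraNT => /h ->.
- move=> w; rewrite /phi; case: asboolP => // wL; rewrite /t divff ?gt_eqF //.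
  by rewrite H1.
- have /realizationP[_ _ hs] := Lc; apply: Ldown hs _.
  by rewrite sub1set label_supp.
Qed.

End Contractible.

(** * Locally null points *)

Definition punctured (R : realType) n (A : set 'rV[R]_n) (p : 'rV[R]_n) (r : R) : set 'rV[R]_n :=
  fun x => [/\ A x, x <> p & ball p r x].

(** The contraction may leave the smaller neighbourhood, which makes the notion invariant under
    local homeomorphisms. Since [c] has to exist, an isolated point is not locally null. *)
Definition locally_null (R : realType) n (A : set 'rV[R]_n) (p : 'rV[R]_n) :=
  forall e : R, 0 < e -> exists2 d : R, 0 < d &
  exists (H : R * 'rV[R]_n -> 'rV[R]_n) (c : 'rV[R]_n),
  [/\ punctured A p e c, cont_on (cylinder (punctured A p d)) H,
      forall t x, 0 <= t <= 1 -> punctured A p d x -> punctured A p e (H (t, x)),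
      forall x, punctured A p d x -> H (0, x) = x
    & forall x, punctured A p d x -> H (1, x) = c].

(** Adding or removing [v] is a sign-reversing involution of the index set. *)
Lemma sum_toggle (V : finType) (v : V) (P : pred {set V}) :
  (forall G, P (v |: G) = P (G :\ v)) -> \sum_(G | P G) (-1) ^+ #|G| = 0 :> int.
Proof.
move=> hP; pose tog (G : {set V}) := if v \in G then G :\ v else v |: G.
have togK : involutive tog.
  move=> G; rewrite /tog; have [vG|vG] := boolP (v \in G).
    by rewrite setD11 setD1K.
  by rewrite setU11 setU1K.
have Ptog G : P (tog G) = P G.
  rewrite /tog; case: ifP => vG; first by rewrite -hP (setUidPr _) ?sub1set.
  by rewrite hP; congr P; apply/setP=> u; rewrite !inE; case: eqP => // ->.
set S := \sum_(G | _) _; suff : S = - S by lia.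
rewrite {1}/S (reindex_inj (inv_inj togK)) /= -sumrN; apply: eq_big => // G _.
rewrite /tog; case: ifP => vG; first by rewrite [in RHS](cardsD1 v) vG exprS mulN1r opprK.
by rewrite cardsU1 vG exprS mulN1r.
Qed.

(** * Links of points in a complex *)

Section Link.
Variables (R : realType) (V : finType) (D : {set {set V}}).
Hypothesis Ddown : forall A B : {set V}, A \in D -> B \subset A -> B \in D.
Implicit Types p q x y : 'rV[R]_#|V|.

Lemma baryD p q v : bary (p + q) v = bary p v + bary q v.
Proof. by rewrite /bary mxE. Qed.
Lemma baryN p v : bary (- p) v = - bary p v.
Proof. by rewrite /bary mxE. Qed.
Lemma baryZ a p v : bary (a *: p) v = a * bary p v.
Proof. by rewrite /bary mxE. Qed.

(* The boundary of [s] joined with its link: the sphere of directions at an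
   interior point of the face [s]. *)
Definition point_link (s : {set V}) : {set {set V}} :=
  [set G : {set V} | (G :|: s \in D) && ~~ (s \subset G)].

Lemma point_link_down s (A B : {set V}) :
  A \in point_link s -> B \subset A -> B \in point_link s.
Proof.
rewrite !inE => /andP[AD sA] BA; apply/andP; split.
  by apply: Ddown AD _; apply: setSU.
by apply: contra sA => /subset_trans; apply.
Qed.

Lemma cont_on_bary (S : pseudoMetricType R) (A : set S) (f : S -> 'rV[R]_#|V|) v :
  cont_on A f -> cont_on A (fun z => bary (f z) v).
Proof. exact: cont_on_coord. Qed.

(** Near [p] the complex is a cone over [point_link (supp p)]. The map [shrink] embeds the link in a
    small punctured neighbourhood and the radial projection [rho] brings points back, with
    [rho (shrink x) = x]; between the two, the local contraction [H] contracts the link. *)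
Lemma link_contractible p : realization D p -> locally_null (@realization R V D) p ->
  contractible (@realization R V (point_link (supp p))).
Proof.
move=> Dp lcp; set s := supp p.
have /realizationP[p0 p1 _] := Dp.
have ps v : v \in s -> 0 < bary p v by rewrite in_supp lt_def p0 andbT.
have pns v : v \notin s -> bary p v = 0 by rewrite in_supp negbK => /eqP.
have [e e0 he] := supp_near p.
have [d d0 [H [c [pc cH He H0 H1]]]] := lcp e e0.
(* The largest multiple of [p] that can be subtracted from [y] with nonnegative result; the default
   1 is never attained away from [p]. The map [rho] subtracts this multiple and normalizes the sum
   to 1. *)
pose m y := \big[Num.min/1]_(v in s) (bary y v / bary p v).
pose rho y := (1 - m y)^-1 *: (y - m y *: p).
have m_le y v : v \in s -> m y * bary p v <= bary y v.
  move=> vs; rewrite -ler_pdivlMr ?ps //; exact: bigmin_le_cond.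
(* Otherwise [y] dominates [p] in every coordinate; both have sum 1, so they coincide. *)
have m_lt1 y : punctured (realization D) p e y -> m y < 1.
  move=> [/realizationP[y0 y1 _] yp _]; rewrite ltNge; apply/negP => m1; apply: yp.
  have ge v : 0 <= bary y v - bary p v.
    case: (boolP (v \in s)) => vs; last by rewrite pns // subr0.
    rewrite subr_ge0; apply: le_trans (m_le y v vs); by rewrite ler_peMl // ltW ?ps.
  have y_p : \sum_v (bary y v - bary p v) = 0 by rewrite sumrB y1 p1 subrr.
  apply: bary_inj => v; apply/eqP; rewrite -subr_eq0; apply/eqP.
  exact: (psumr_eq0P (fun u _ => ge u) y_p).
(* As [m y < 1], the minimum is reached at a vertex of [s], where the coordinate of [rho y]
   vanishes. So the support of [rho y] does not contain [s]. *)
have m_att y : punctured (realization D) p e y -> exists2 v, v \in s & bary y v = m y * bary p v.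
  move=> py; have [//|h] := pselect (exists2 v, v \in s & bary y v = m y * bary p v).
  suff : m y < m y by rewrite ltxx.
  rewrite {2}/m; apply/bigmin_gtP; split=> [|v vs]; first exact: m_lt1.
  rewrite ltr_pdivlMr ?ps // lt_neqAle m_le // andbT; apply/eqP => E; apply: h; by exists v.
have rhoE y v : bary (rho y) v = (bary y v - m y * bary p v) / (1 - m y).
  by rewrite /rho baryZ baryD baryN baryZ mulrC.
have rhoL y : punctured (realization D) p e y -> realization (point_link s) (rho y).
  move=> py; have [/realizationP[y0 y1 yD] yp bpy] := py.
  have m1 : 0 < 1 - m y by rewrite subr_gt0 m_lt1.
  apply/realizationP; split=> [v||].
  - rewrite rhoE; apply: divr_ge0; last exact: ltW.
    rewrite subr_ge0; case: (boolP (v \in s)) => vs; first exact: m_le.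
    by rewrite pns // mulr0.
  - under eq_bigr => v _ do rewrite rhoE.
    by rewrite -mulr_suml sumrB -mulr_sumr y1 p1 mulr1 divff ?gt_eqF.
  - rewrite inE; apply/andP; split.
      apply: Ddown yD _; rewrite subUset he // andbT; apply/subsetP=> v.
      rewrite !in_supp rhoE; apply: contraNneq => yv.
      have : v \notin s by apply: contraT; rewrite negbK => /(subsetP (he _ bpy)); rewrite in_supp yv eqxx.
      by move/pns=> ->; rewrite yv mulr0 subrr mul0r.
    have [v vs yv] := m_att y py; apply/negP => /subsetP/(_ v vs).
    by rewrite in_supp rhoE yv subrr mul0r eqxx.
pose k := Num.min (d / 2) (1 / 2).
have k0 : 0 < k by rewrite lt_min !divr_gt0.
have k1 : k < 1 by rewrite gt_min; apply/orP; right; lra.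
have kd : k < d by rewrite gt_min; apply/orP; left; lra.
pose shrink x := (1 - k) *: p + k *: x.
have shE x v : bary (shrink x) v = (1 - k) * bary p v + k * bary x v by rewrite baryD !baryZ.
have shP x : realization (point_link s) x -> punctured (realization D) p d (shrink x).
  move=> Lx; have /realizationP[x0 x1] := Lx; rewrite inE => /andP[xD sx]; split.
  - apply/realizationP; split=> [v||].
    + by rewrite shE addr_ge0 // mulr_ge0 // ?subr_ge0 ltW.
    + under eq_bigr => v _ do rewrite shE.
      by rewrite big_split /= -!mulr_sumr p1 x1 !mulr1 subrK.
    + apply: Ddown xD _; apply/subsetP=> v; rewrite in_setU !in_supp shE.
      apply: contraNT; rewrite negb_or !negbK => /andP[/eqP-> /eqP->].
      by rewrite !mulr0 addr0.
  - move=> E; case/negP: sx; suff -> : x = p by [].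
    apply: bary_inj => v; have := shE x v; rewrite E => E'.
    have : k * (bary x v - bary p v) = 0 by lra.
    by move/eqP; rewrite mulf_eq0 gt_eqF //= subr_eq0 => /eqP.
  - apply/ball_baryP => // v; rewrite shE.
    have -> : bary p v - ((1 - k) * bary p v + k * bary x v) = k * (bary p v - bary x v) by ring.
    rewrite normrM gtr0_norm //; apply: le_lt_trans kd; rewrite ger_pMr //.
    have := x0 v; have := p0 v; have := bary_le1 v Lx; have := bary_le1 v Dp.
    by move=> *; rewrite ler_norml; apply/andP; split; lra.
have m_sh x : realization (point_link s) x -> m (shrink x) = 1 - k.
  move=> /realizationP[x0 x1]; rewrite inE => /andP[_ /subsetPn[v vs vx]].
  apply/eqP; rewrite eq_le; apply/andP; split.
    rewrite -(ler_pM2r (ps v vs)); apply: (le_trans (m_le _ v vs)); rewrite shE.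
    by move: vx; rewrite in_supp negbK => /eqP->; rewrite mulr0 addr0.
  apply/bigmin_geP; split=> [|u us]; first by lra.
  by rewrite ler_pdivlMr ?ps // shE lerDl mulr_ge0 // ltW.
have rho_sh x : realization (point_link s) x -> rho (shrink x) = x.
  move=> Lx; apply: bary_inj => v; rewrite rhoE m_sh // shE.
  by field; rewrite gt_eqF //; lra.
have cm : cont_on (punctured (realization D) p e) m.
  apply: cont_on_bigmin => v _; apply: cont_onM; last exact: cont_on_cst.
  apply: cont_on_bary; exact: cont_on_id.
have crho : cont_on (punctured (realization D) p e) rho.
  apply: cont_on_row => i; rewrite -(enum_valK i).
  rewrite (_ : (fun x => _) =
    (fun y => (bary y (enum_val i) - m y * bary p (enum_val i)) / (1 - m y))); last first.
    by apply/funext => y; apply: rhoE.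
  apply: cont_onM.
    apply: cont_onB; first by apply: cont_on_bary; exact: cont_on_id.
    by apply: cont_onM => //; exact: cont_on_cst.
  apply: cont_onV; first by apply: cont_onB => //; exact: cont_on_cst.
  by move=> y /m_lt1 h; rewrite gt_eqF ?subr_gt0.
exists (fun z => rho (H (z.1, shrink z.2))), (rho c); split.
- exact: rhoL.
- apply: (cont_on_comp (B := punctured (realization D) p e)) crho _ => /=.
    apply: (cont_on_comp (f := fun z : R * 'rV[R]_#|V| => (z.1, shrink z.2)) _ cH).
      apply: cont_on_pair; first exact: cont_on_fst.
      apply: cont_on_row => i; rewrite -(enum_valK i).
      rewrite (_ : (fun z => _) = (fun z : R * 'rV[R]_#|V| =>
        (1 - k) * bary p (enum_val i) + k * bary z.2 (enum_val i))); last first.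
        by apply/funext => y; apply: shE.
      apply: cont_onD; first exact: cont_on_cst.
      apply: cont_onM; first exact: cont_on_cst.
      apply: cont_on_bary; exact: cont_on_snd.
    by move=> [t x] [/= t01 Lx]; split=> //=; apply: shP.
  by move=> [t x] [/= t01 Lx]; apply: He => //; apply: shP.
- by move=> t x t01 Lx /=; apply: rhoL; apply: He => //; apply: shP.
- by move=> x Lx /=; rewrite H0 ?rho_sh //; apply: shP.
- by move=> x Lx /=; rewrite H1 //; apply: shP.
Qed.

(** Up to sign, the reduced Euler characteristic of the link of [s]; it is an empty sum when [s] is
    not a face. *)
Definition link_euler (s : {set V}) : int := \sum_(G in D | s \subset G) (-1) ^+ #|G :\: s|.

(** The signed sum over all [G] with [G :|: s] a face is zero, by toggling a vertex of [s]. The [G]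
    not containing [s] form [point_link s], whose sum is zero by contractibility, so the sum over
    the faces containing [s] is zero too. *)
Lemma locally_null_euler p : realization D p -> locally_null (@realization R V D) p ->
  link_euler (supp p) = 0.
Proof.
move=> Dp lcp; set s := supp p.
have [v vs] : exists v, v \in s.
  apply/set0Pn; apply/eqP => s0; have /realizationP[_ + _] := Dp.
  rewrite big1 => [/eqP|v _]; first by rewrite eq_sym oner_eq0.
  by apply/eqP; rewrite -[_ == _]negbK -in_supp -/s s0 inE.
have h1 := contractible_euler (@point_link_down s) (link_contractible Dp lcp).
have h2 : \sum_(G : {set V} | G :|: s \in D) (-1) ^+ #|G| = 0 :> int.
  apply: (@sum_toggle _ v) => G; congr (_ \in D); apply/setP=> u.
  rewrite !in_setU in_setD1 in_set1.
  by case: eqP => [->|]; rewrite ?vs ?orbT.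
have : \sum_(G in D | s \subset G) (-1) ^+ #|G| = 0 :> int.
  move: h2; rewrite (bigID (fun G : {set V} => s \subset G)) /=.
  rewrite [X in _ + X](eq_bigl (fun G => G \in point_link s)) ?h1 ?addr0 => [<-|G]; last by rewrite inE.
  apply: eq_bigl => G; rewrite andbC [RHS]andbC; case: (boolP (s \subset G)) => //= sG.
  by rewrite (setUidPl sG).
rewrite /link_euler => h.
rewrite (eq_bigr (fun G : {set V} => (-1) ^+ #|s| * (-1) ^+ #|G|)) => [|G /andP[_ sG]].
  by rewrite -mulr_sumr h mulr0.
by rewrite -(cardsID s G) (setIidPr sG) exprD mulrA -expr2 sqrr_sign mul1r.
Qed.

End Link.

(** * Invariance of local nullity, and its behaviour in balls and spheres *)

Section LocallyNull.
Variable R : realType.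

(** The contraction is conjugated by [f] and [g], with radii shrunk by continuity. The maps need to
    be mutually inverse only within [r] of [p] and [q], which admits translations between interior
    points of a ball. *)
Lemma locally_null_transfer n n' (A : set 'rV[R]_n) (B : set 'rV[R]_n') f g p q (r : R) :
  0 < r -> A p -> B q -> f p = q -> g q = p ->
  (forall x, A x -> ball p r x -> B (f x) /\ g (f x) = x) ->
  (forall y, B y -> ball q r y -> A (g y) /\ f (g y) = y) ->
  cont_on (fun x => A x /\ ball p r x) f -> cont_on (fun y => B y /\ ball q r y) g ->
  locally_null B q -> locally_null A p.
Proof.
move=> r0 Ap Bq fp gq hf hg cf cg lcB e e0.
have bp : ball p r p by apply: ballxx.
have bq : ball q r q by apply: ballxx.
have [e1 e10 he1] := proj1 (cont_onP _ _) cg q (conj Bq bq) e e0.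
pose e' := Num.min e1 r.
have e'0 : 0 < e' by rewrite lt_min e10.
have [d' d'0 [H [c [pc cH He H0 H1]]]] := lcB e' e'0.
have [d1 d10 hd1] := proj1 (cont_onP _ _) cf p (conj Ap bp) d' d'0.
pose d := Num.min d1 r.
have d0 : 0 < d by rewrite lt_min d10.
have pf x : punctured A p d x -> punctured B q d' (f x) /\ g (f x) = x.
  move=> [Ax xp px].
  have pxr : ball p r x by apply: le_ball px; rewrite ge_min lexx orbT.
  have [Bfx gfx] := hf x Ax pxr; split=> //; split=> //.
    by move=> E; apply: xp; rewrite -gfx E.
  rewrite -fp; apply: hd1 => //; apply: le_ball px; by rewrite ge_min lexx.
have pg y : punctured B q e' y -> punctured A p e (g y).
  move=> [By yq qy].
  have qyr : ball q r y by apply: le_ball qy; rewrite ge_min lexx orbT.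
  have [Agy fgy] := hg y By qyr; split=> //.
    by move=> E; apply: yq; rewrite -fgy E.
  rewrite -gq; apply: he1 => //; apply: le_ball qy; by rewrite ge_min lexx.
exists d => //; exists (fun z => g (H (z.1, f z.2))), (g c); split.
- exact: pg.
- apply: (cont_on_comp (B := fun y => B y /\ ball q r y) _ cg) => /=.
    apply: (cont_on_comp (f := fun z : R * 'rV[R]_n => (z.1, f z.2)) _ cH).
      apply: cont_on_pair; first exact: cont_on_fst.
      apply: (cont_on_comp _ cf); first exact: cont_on_snd.
      move=> z [_ [Az _ pz]]; split=> //; apply: le_ball pz; by rewrite ge_min lexx orbT.
    by move=> [t x] [/= t01 px]; split=> //=; have [] := pf _ px.
  move=> [t x] [/= t01 /pf[px _]]; have [By _ qy] := He _ _ t01 px; split=> //.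
  by apply: le_ball qy; rewrite ge_min lexx orbT.
- by move=> t x t01 /pf[px _] /=; apply/pg/He.
- by move=> x /pf[px gfx] /=; rewrite H0.
- by move=> x /pf[px gfx] /=; rewrite H1.
Qed.

Lemma homeomorphic_locally_null n n' (A : set 'rV[R]_n) (B : set 'rV[R]_n') f g p :
  cont_on A f -> cont_on B g -> (forall x, A x -> B (f x)) -> (forall y, B y -> A (g y)) ->
  (forall x, A x -> g (f x) = x) -> (forall y, B y -> f (g y) = y) ->
  A p -> locally_null B (f p) -> locally_null A p.
Proof.
move=> cf cg AB BA gf fg Ap.
apply: (@locally_null_transfer _ _ A B f g p (f p) 1) => //; rewrite ?gf //.
- exact: AB.
- by move=> x Ax _; split; [apply: AB|apply: gf].
- by move=> y By _; split; [apply: BA|apply: fg].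
- by apply: cont_onS cf => x [].
- by apply: cont_onS cg => x [].
Qed.

(** The straight-line homotopy to [c], in the shape of the homotopies above: time first, then
    point. *)
Definition segment n (c : 'rV[R]_n) (z : R * 'rV[R]_n) : 'rV[R]_n :=
  (1 - z.1) *: z.2 + z.1 *: c.

Lemma segmentE n (c : 'rV[R]_n) z i :
  segment c z ord0 i = (1 - z.1) * z.2 ord0 i + z.1 * c ord0 i.
Proof. by rewrite !mxE. Qed.

Lemma cont_on_segment n (c : 'rV[R]_n) A : cont_on A (segment c).
Proof.
apply: cont_on_row => i.
rewrite (_ : (fun z => _) = (fun z : R * 'rV[R]_n => (1 - z.1) * z.2 ord0 i + z.1 * c ord0 i)); last first.
  by apply/funext => z; apply: segmentE.
apply: cont_onD; apply: cont_onM; try exact: cont_on_cst; try exact: cont_on_fst.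
- by apply: cont_onB; [exact: cont_on_cst|exact: cont_on_fst].
- by apply: cont_on_coord; exact: cont_on_snd.
Qed.

Lemma segment0 n (c x : 'rV[R]_n) : segment c (0, x) = x.
Proof. by rewrite /segment subr0 scale1r scale0r addr0. Qed.

Lemma segment1 n (c x : 'rV[R]_n) : segment c (1, x) = c.
Proof. by rewrite /segment subrr scale1r scale0r add0r. Qed.

Lemma segment_ball n (p c x : 'rV[R]_n) (e t : R) : 0 < e -> 0 <= t <= 1 ->
  ball p e c -> ball p e x -> ball p e (segment c (t, x)).
Proof.
move=> e0 /andP[t0 t1] /(rV_ballP _ _ e0) hc /(rV_ballP _ _ e0) hx.
apply/(rV_ballP _ _ e0) => i; rewrite segmentE /=.
have := hc i; have := hx i; rewrite !ltr_norml => /andP[a1 a2] /andP[b1 b2].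
set a := p ord0 i in a1 a2 b1 b2 *; set b := x ord0 i in a1 a2 *; set d := c ord0 i in b1 b2 *.
have -> : a - ((1 - t) * b + t * d) = (1 - t) * (a - b) + t * (a - d) by ring.
have [t1'|ht] := ltP t 1; last first.
  have -> : t = 1 by lra.
  by rewrite subrr mul0r add0r mul1r; apply/andP; split.
have h1 : 0 < 1 - t by lra.
by apply/andP; split; nra.
Qed.

Section Euclid.
Variable n : nat.
Implicit Types p q x y u : 'rV[R]_n.

Definition dot x y : R := \sum_i x ord0 i * y ord0 i.

Lemma dotC x y : dot x y = dot y x.
Proof. by apply: eq_bigr => i _; rewrite mulrC. Qed.
Lemma dotDl x y u : dot (x + y) u = dot x u + dot y u.
Proof. by rewrite /dot -big_split; apply: eq_bigr => i _; rewrite mxE mulrDl. Qed.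
Lemma dotZl a x u : dot (a *: x) u = a * dot x u.
Proof. by rewrite /dot mulr_sumr; apply: eq_bigr => i _; rewrite mxE mulrA. Qed.
Lemma dotDr x y u : dot u (x + y) = dot u x + dot u y.
Proof. by rewrite dotC dotDl !(dotC u). Qed.
Lemma dotZr a x u : dot u (a *: x) = a * dot u x.
Proof. by rewrite dotC dotZl (dotC u). Qed.
Lemma dotNl x u : dot (- x) u = - dot x u.
Proof. by rewrite -scaleN1r dotZl mulN1r. Qed.
Lemma dotNr x u : dot u (- x) = - dot u x.
Proof. by rewrite dotC dotNl (dotC u). Qed.

Lemma dot_ge0 x : 0 <= dot x x.
Proof. by apply: sumr_ge0 => i _; rewrite -expr2 sqr_ge0. Qed.

Lemma dot_eq0 x : dot x x = 0 -> x = 0.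
Proof.
move=> h; apply/rowP => i; rewrite mxE; apply/eqP.
have : x ord0 i * x ord0 i = 0.
  by apply: (psumr_eq0P (F := fun i => x ord0 i * x ord0 i) _ h) => // j _; rewrite -expr2 sqr_ge0.
by move/eqP; rewrite mulf_eq0 orbb.
Qed.

Lemma dot_gt0 x : x <> 0 -> 0 < dot x x.
Proof. by move=> x0; rewrite lt_def dot_ge0 andbT; apply/eqP => /dot_eq0. Qed.

Lemma unit_ballE x : @unit_ball R n x = (dot x x <= 1).
Proof. by rewrite /unit_ball /dot /=; under eq_bigr do rewrite expr2. Qed.

Lemma unit_sphereE x : @unit_sphere R n x = (dot x x = 1).
Proof. by rewrite /unit_sphere /dot /=; under eq_bigr do rewrite expr2. Qed.

Lemma cont_on_dot (S : pseudoMetricType R) (A : set S) (f g : S -> 'rV[R]_n) :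
  cont_on A f -> cont_on A g -> cont_on A (fun z => dot (f z) (g z)).
Proof.
by move=> cf cg; apply: cont_on_sum => i _; apply: cont_onM; apply: cont_on_coord.
Qed.

(** Convexity of the unit ball: the squared norm at time [t] is [(1 - t)|x|^2 + t|c|^2 - t(1 - t)|x
    - c|^2]. *)
Lemma dot_segment_le c x t : 0 <= t <= 1 -> dot c c <= 1 -> dot x x <= 1 ->
  dot (segment c (t, x)) (segment c (t, x)) <= 1.
Proof.
move=> /andP[t0 t1] c1 x1; rewrite /segment /= !(dotDl, dotDr, dotZl, dotZr) (dotC c x).
have : 0 <= dot (x - c) (x - c) by apply: dot_ge0.
rewrite !(dotDl, dotDr, dotNl, dotNr) (dotC c x) => h.
set a := dot x x in x1 h *; set b := dot c c in c1 h *; set d := dot x c in h *.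
have tt : 0 <= t * (1 - t) by rewrite mulr_ge0 // subr_ge0.
have h' : 0 <= (t * (1 - t)) * (a + b - d * 2) by apply: mulr_ge0 => //; lra.
have ha : 0 <= (1 - t) * (1 - a) by rewrite mulr_ge0 // subr_ge0.
have hb : 0 <= t * (1 - b) by rewrite mulr_ge0 // subr_ge0.
nra.
Qed.

(* [p] is an extreme point of the ball, so the punctured ball is convex. *)
Lemma unit_ball_boundary_null p : dot p p = 1 -> locally_null (@unit_ball R n) p.
Proof.
move=> p1 e e0; exists e => //.
pose k := Num.min (e / 2) (1 / 2).
have k0 : 0 < k by rewrite lt_min !divr_gt0.
have k1 : k < 1 by rewrite gt_min; apply/orP; right; lra.
have ke : k < e by rewrite gt_min; apply/orP; left; lra.
pose c := (1 - k) *: p.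
(* The functional [dot _ p] reaches 1 on the ball only at [p]; hence no segment between two other
   points of the ball passes through [p]. *)
have ltp x : dot x x <= 1 -> x <> p -> dot x p < 1.
  move=> x1 xp; have : 0 < dot (x - p) (x - p) by apply: dot_gt0 => /eqP; rewrite subr_eq0 => /eqP.
  by rewrite !(dotDl, dotDr, dotNl, dotNr) (dotC p x) p1; lra.
have pc : punctured (@unit_ball R n) p e c.
  split.
  - by rewrite unit_ballE /c dotZl dotZr p1 mulr1; nra.
  - move=> E; have : dot c p = 1 by rewrite E.
    by rewrite /c dotZl p1; lra.
  - apply/rV_ballP => // i; rewrite mxE.
    have -> : p ord0 i - (1 - k) * p ord0 i = k * p ord0 i by ring.
    rewrite normrM gtr0_norm //; apply: le_lt_trans ke; rewrite ger_pMr //.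
    have : p ord0 i ^+ 2 <= 1.
      rewrite -p1 /dot (bigD1 i) //= -expr2 lerDl; apply: sumr_ge0 => j _.
      by rewrite -expr2 sqr_ge0.
    by rewrite -[1 as X in _ <= X -> _](expr1n _ 2) -real_normK ?num_real // ler_pXn2r // nnegrE.
have [cB cp cb] := pc; rewrite unit_ballE in cB.
exists (segment c), c; split=> //.
- exact: cont_on_segment.
- move=> t x t01 [xB xp xb]; rewrite unit_ballE in xB; split.
  + by rewrite unit_ballE; apply: dot_segment_le.
  + move=> E; have : dot (segment c (t, x)) p = 1 by rewrite E.
    rewrite /segment /= dotDl (dotZl (1 - t)) (dotZl t).
    have := ltp x xB xp; have := ltp c cB cp; set a := dot x p; set b := dot c p => hb ha.
    case/andP: t01 => t0 t1.
    have h1 : 0 <= (1 - t) * (1 - a) by rewrite mulr_ge0 // subr_ge0 // ltW.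
    move: t0; rewrite le_eqVlt => /predU1P[<-|t0]; first by lra.
    have h2 : 0 < t * (1 - b) by rewrite mulr_gt0 // subr_gt0.
    move=> E'; have : 1 - ((1 - t) * a + t * b) = (1 - t) * (1 - a) + t * (1 - b) by ring.
    by rewrite E' subrr => h3; have := ltr_wpDl h1 h2; rewrite -h3 ltxx.
  + exact: segment_ball.
- by move=> x _; apply: segment0.
- by move=> x _; apply: segment1.
Qed.

Lemma interior_ball p : dot p p < 1 -> exists2 r : R, 0 < r & forall x, ball p r x -> dot x x < 1.
Proof.
move=> p1; have e0 : 0 < 1 - dot p p by lra.
have cd : cont_on (fun=> True : Prop) (fun x : 'rV[R]_n => dot x x).
  by apply: cont_on_dot; apply: cont_on_id.
have [r r0 hr] := proj1 (cont_onP _ _) cd p I _ e0.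
exists r => // x /(hr x I); rewrite -[ball _ _ _]/(is_true (`|_ - _| < _)) ltr_norml => /andP[h1 h2].
lra.
Qed.

Lemma cont_on_translate (a : 'rV[R]_n) A : cont_on A (fun x => x + a).
Proof.
apply: cont_on_row => i.
rewrite (_ : (fun z => _) = (fun z : 'rV[R]_n => z ord0 i + a ord0 i)); last first.
  by apply/funext => z; rewrite mxE.
by apply: cont_onD; [apply: cont_on_coord; exact: cont_on_id|exact: cont_on_cst].
Qed.

(** Translation by [q - p] identifies small neighbourhoods of the two points, both chosen inside the
    open ball. *)
Lemma unit_ball_interior_null p q : dot p p < 1 -> dot q q < 1 ->
  locally_null (@unit_ball R n) q -> locally_null (@unit_ball R n) p.
Proof.
move=> p1 q1.
have [r r0 hr] := interior_ball p1; have [r' r'0 hr'] := interior_ball q1.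
pose s := Num.min r r'; have s0 : 0 < s by rewrite lt_min r0.
have shift (a b x : 'rV[R]_n) : ball a s x -> ball b s (x + (b - a)).
  move=> /(rV_ballP _ _ s0) h; apply/(rV_ballP _ _ s0) => i; rewrite !mxE.
  by have := h i; rewrite !ltr_norml => /andP[h1 h2]; apply/andP; split; lra.
apply: (@locally_null_transfer n n _ _ (fun x => x + (q - p)) (fun x => x + (p - q)) p q s) => //.
- by rewrite unit_ballE ltW.
- by rewrite unit_ballE ltW.
- by rewrite addrC subrK.
- by rewrite addrC subrK.
- move=> x _ /(shift _ q) h; split; last by apply/rowP => i; rewrite !mxE; ring.
  by rewrite unit_ballE ltW //; apply: hr'; apply: le_ball h; rewrite ge_min lexx orbT.
- move=> x _ /(shift _ p) h; split; last by apply/rowP => i; rewrite !mxE; ring.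
  by rewrite unit_ballE ltW //; apply: hr; apply: le_ball h; rewrite ge_min lexx.
- exact: cont_on_translate.
- exact: cont_on_translate.
Qed.

(* The reflection exchanging [p] and [q] is a homeomorphism of the sphere. *)
Lemma unit_sphere_null p q : dot p p = 1 -> dot q q = 1 ->
  locally_null (@unit_sphere R n) q -> locally_null (@unit_sphere R n) p.
Proof.
move=> p1 q1; have [->//|/eqP pq] := eqVneq p q.
pose u := p - q.
have u0 : 0 < dot u u by apply: dot_gt0 => /eqP; rewrite subr_eq0 => /eqP.
pose f x := x - (2 * dot x u / dot u u) *: u.
have fu x : dot (f x) u = - dot x u.
  by rewrite /f dotDl dotNl dotZl; field; rewrite gt_eqF.
have ff x : f (f x) = x.
  rewrite {1}/f fu /f -addrA -opprD -scalerDl mulrN mulNr addrC.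
  by rewrite subrr scale0r oppr0 add0r.
have fS x : @unit_sphere R n x -> @unit_sphere R n (f x).
  rewrite !unit_sphereE => <-; rewrite {2}/f dotDr dotNr dotZr fu dotC /f dotDr dotNr dotZr.
  by field; rewrite gt_eqF.
have fp : f p = q.
  have -> : f p = p - 1 *: u.
    congr (_ - _ *: _); apply: (canLR (mulfK _)); first by rewrite gt_eqF.
    by rewrite /u !(dotDl, dotDr, dotNl, dotNr) (dotC q p) p1 q1; ring.
  by rewrite scale1r /u subKr.
have cf : cont_on (@unit_sphere R n) f.
  apply: cont_on_row => i.
  rewrite (_ : (fun z => _) = (fun x : 'rV[R]_n => x ord0 i - 2 * dot x u / dot u u * u ord0 i)); last first.
    by apply/funext => z; rewrite /f !mxE.
  apply: cont_onB; first by apply: cont_on_coord; exact: cont_on_id.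
  apply: cont_onM; last exact: cont_on_cst.
  apply: cont_onM; last exact: cont_on_cst.
  apply: cont_onM; first exact: cont_on_cst.
  by apply: cont_on_dot; [exact: cont_on_id|exact: cont_on_cst].
by rewrite -fp; apply: (homeomorphic_locally_null cf cf).
Qed.

End Euclid.

End LocallyNull.

(** * Links of faces in balls and spheres *)

(** The straight-line contraction of the ball to its centre, carried over to [A]. *)
Lemma ball_contractible (R : realType) n d (A : set 'rV[R]_n)
    (f : 'rV[R]_n -> 'rV[R]_d) (g : 'rV[R]_d -> 'rV[R]_n) :
  cont_on A f -> cont_on (@unit_ball R d) g ->
  (forall x, A x -> unit_ball (f x)) -> (forall y, unit_ball y -> A (g y)) ->
  (forall x, A x -> g (f x) = x) -> contractible A.
Proof.
move=> cf cg AB BA gf.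
have B0 : @unit_ball R d 0 by rewrite unit_ballE /dot big1 ?ler01 // => i _; rewrite mxE mul0r.
have Bseg t x : 0 <= t <= 1 -> A x -> @unit_ball R d (segment 0 (t, f x)).
  by move=> t01 /AB; rewrite unit_ballE => fx; rewrite unit_ballE; apply: dot_segment_le => //.
exists (fun z => g (segment 0 (z.1, f z.2))), (g 0); split.
- exact: BA.
- apply: (cont_on_comp _ cg) => [|[t x] [/= t01 Ax]]; last exact: Bseg.
  apply: (cont_on_comp (f := fun z : R * 'rV[R]_n => (z.1, f z.2)) (B := fun=> True : Prop)) => //.
    apply: cont_on_pair; first exact: cont_on_fst.
    by apply: (cont_on_comp _ cf) => [|z [_ Az]//]; exact: cont_on_snd.
  exact: cont_on_segment.
- by move=> t x t01 Ax /=; apply: BA; apply: Bseg.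
- by move=> x Ax /=; rewrite segment0 gf.
- by move=> x Ax /=; rewrite segment1.
Qed.

Lemma homeomorphic_cont (R : realType) n n' (A : set 'rV[R]_n) (B : set 'rV[R]_n') : homeomorphic A B ->
  exists f g, [/\ cont_on A f, cont_on B g, forall x, A x -> B (f x), forall y, B y -> A (g y)
    & (forall x, A x -> g (f x) = x) /\ (forall y, B y -> f (g y) = y)].
Proof.
by move=> [f [g [cf cg AB BA K]]]; exists f, g; split=> //; apply/subspace_continuousP.
Qed.

Section BallOrSphere.
Variables (R : realType) (V : finType) (D : {set {set V}}).
Hypothesis Ddown : forall A B : {set V}, A \in D -> B \subset A -> B \in D.
Implicit Types p q x y : 'rV[R]_#|V|.

Lemma bary_segment c t x v : bary (segment c (t, x)) v = (1 - t) * bary x v + t * bary c v.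
Proof. exact: segmentE. Qed.

Lemma realization_segment c t x : 0 <= t <= 1 -> realization D c -> realization D x ->
  supp c :|: supp x \in D -> realization D (segment c (t, x)).
Proof.
move=> /andP[t0 t1] /realizationP[c0 c1 _] /realizationP[x0 x1 _] cx.
apply/realizationP; split=> [v||].
- by rewrite bary_segment addr_ge0 // mulr_ge0 // subr_ge0.
- under eq_bigr => v _ do rewrite bary_segment.
  by rewrite big_split /= -!mulr_sumr c1 x1 !mulr1 subrK.
- apply: Ddown cx _; apply/subsetP=> v; rewrite in_setU !in_supp bary_segment.
  apply: contraNT; rewrite negb_or !negbK => /andP[/eqP-> /eqP->].
  by rewrite !mulr0 addr0.
Qed.

Definition barycenter (s : {set V}) : 'rV[R]_#|V| :=
  point_of (fun v => (v \in s)%:R / #|s|%:R).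

Lemma supp_barycenter s : s != set0 -> supp (barycenter s) = s.
Proof.
move=> s0; apply/setP=> v; rewrite in_supp bary_point mulf_eq0 invr_eq0 !pnatr_eq0 cards_eq0.
by rewrite (negbTE s0) orbF eqb0 negbK.
Qed.

Lemma barycenterP s : s != set0 -> s \in D -> realization D (barycenter s).
Proof.
move=> s0 sD; apply/realizationP; rewrite supp_barycenter //; split=> // [v|].
  by rewrite bary_point divr_ge0.
under eq_bigr => v _ do rewrite bary_point.
rewrite -mulr_suml -natr_sum -big_mkcond sum1_card divff // pnatr_eq0 cards_eq0 //.
Qed.

(** Near [p] all points lie in the single simplex [v0 |: s], in which [p] is on the face where the
    coordinate at [v0] vanishes. Contracting to a point [c] with positive coordinate at [v0]
    therefore avoids [p]. *)
Lemma free_face_null (s : {set V}) v0 p : v0 \notin s -> v0 |: s \in D ->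
  (forall G, G \in D -> s \subset G -> G \subset v0 |: s) ->
  realization D p -> supp p = s -> locally_null (@realization R V D) p.
Proof.
move=> v0s tD hs Dp ps e e0.
have pv0 : bary p v0 = 0 by apply/eqP; rewrite -[_ == _]negbK -in_supp ps.
have [e2 e20 he2] := supp_near p.
pose d := Num.min e e2.
have d0 : 0 < d by rewrite lt_min e0.
pose k := Num.min (e / 2) (1 / 2).
have k0 : 0 < k by rewrite lt_min !divr_gt0.
have k1 : k < 1 by rewrite gt_min; apply/orP; right; lra.
have ke : k < e by rewrite gt_min; apply/orP; left; lra.
have v0D : [set v0] \in D by apply: Ddown tD _; apply: subsetUl.
have v00 : [set v0] != set0 by apply/set0Pn; exists v0; rewrite set11.
pose b := barycenter [set v0].
have Db : realization D b by apply: barycenterP.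
have bv0 : bary b v0 = 1 by rewrite bary_point set11 cards1 invr1 mulr1.
pose c := segment b (k, p).
have cv0 : bary c v0 = k by rewrite bary_segment pv0 bv0 mulr0 add0r mulr1.
have Dc : realization D c.
  by apply: realization_segment => //; rewrite ?ltW ?k0 //= supp_barycenter // ps.
have csub : supp c \subset v0 |: s.
  apply/subsetP=> v; rewrite in_supp bary_segment; apply: contraR.
  rewrite in_setU1 negb_or -ps in_supp negbK => /andP[vv0 /eqP->].
  by rewrite bary_point in_set1 (negbTE vv0) mul0r !mulr0 addr0.
have pc : punctured (realization D) p e c.
  split=> // [E|]; first by move: cv0; rewrite E pv0 => E'; rewrite -E' ltxx in k0.
  apply/ball_baryP => // v; rewrite bary_segment.
  have -> : bary p v - ((1 - k) * bary p v + k * bary b v) = k * (bary p v - bary b v) by ring.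
  rewrite normrM gtr0_norm //; apply: le_lt_trans ke; rewrite ger_pMr //.
  have /realizationP[/(_ v) b0 _ _] := Db; have /realizationP[/(_ v) p0 _ _] := Dp.
  have := bary_le1 v Db; have := bary_le1 v Dp.
  by move=> *; rewrite ler_norml; apply/andP; split; lra.
have [_ _ cb] := pc.
exists d => //; exists (segment c), c; split=> //.
- exact: cont_on_segment.
- move=> t x t01 [Dx xp px].
  have xs : supp x \subset v0 |: s.
    have /realizationP[_ _ xD] := Dx; apply: hs => //; rewrite -ps; apply: he2.
    by apply: le_ball px; rewrite ge_min lexx orbT.
  split.
  + by apply: realization_segment => //; apply: Ddown tD _; rewrite subUset csub.
  (* For positive time the coordinate at [v0] is positive, unlike that of [p]; at time 0 the point
     is [x], different from [p]. *)
  + move=> E; have := bary_segment c t x v0; rewrite E pv0 cv0.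
    have /realizationP[/(_ v0) x0 _ _] := Dx; case/andP: t01 => t0 t1.
    move: t0; rewrite le_eqVlt => /predU1P[t0|t0] h.
      by apply: xp; rewrite -E -t0 segment0.
    have h1 : 0 < t * k by rewrite mulr_gt0.
    have h2 : 0 <= (1 - t) * bary x v0 by rewrite mulr_ge0 // subr_ge0.
    by have := ltr_wpDl h2 h1; rewrite -h ltxx.
  + apply: segment_ball => //; apply: le_ball px; by rewrite ge_min lexx.
- by move=> x _; apply: segment0.
- by move=> x _; apply: segment1.
Qed.

(** The face [s1] lies in the single facet [t], so its points are locally null, whereas those inside
    [t] are not. This rules out the sphere. In the ball it puts the points of [s1] on the boundary,
    and those of [s] as well because the boundary is closed; boundary points are locally null. *)
Theorem ball_or_sphere_link_euler (s s1 : {set V}) (v0 : V) :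
  is_ball_or_sphere R D -> s \subset s1 -> v0 \notin s1 -> v0 |: s1 \in D ->
  (forall G, G \in D -> s1 \subset G -> G \subset v0 |: s1) ->
  link_euler D s = 0.
Proof.
move=> bs ss1 v0s1 tD hs1.
set t := v0 |: s1 in tD hs1 *.
have t0 : t != set0 by apply/set0Pn; exists v0; rewrite setU11.
pose q := barycenter t.
have Dq : realization D q by apply: barycenterP.
(* The only face containing the facet [t] is [t] itself, so its alternating sum is 1. *)
have nq : ~ locally_null (@realization R V D) q.
  move=> /(locally_null_euler Ddown Dq); rewrite supp_barycenter // /link_euler.
  rewrite (bigD1 t) /=; last by rewrite tD subxx.
  rewrite setDv cards0 expr0 big1 // => G /andP[/andP[GD tG] Gt].
  case/negP: Gt; rewrite eqEsubset tG andbT; apply: hs1 => //.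
  by apply: subset_trans tG; apply: subsetUr.
have s1D : s1 \in D by apply: Ddown tD _; apply: subsetUr.
have nullp p : realization D p -> supp p = s1 -> locally_null (@realization R V D) p.
  by move=> Dp; apply: free_face_null tD hs1 Dp.
case: bs => -[d /homeomorphic_cont[f [g [cf cg AB BA [gf fg]]]]]; last first.
  (* All points of a sphere are alike, so failure of local nullity at [q] spreads to every point. *)
  have nullB p : realization D p -> ~ locally_null (@realization R V D) p.
    move=> Dp nullp'; apply: nq; apply: (homeomorphic_locally_null cf cg) => //.
    apply: (@unit_sphere_null R d _ (f p)); try by rewrite -unit_sphereE; apply: AB.
    apply: (homeomorphic_locally_null cg cf) => //; first exact: AB.
    by rewrite gf.
  have [s10|s10] := eqVneq s1 set0; last first.
    case: (nullB (barycenter s1)); first exact: barycenterP.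
    by apply: nullp; [exact: barycenterP|exact: supp_barycenter].
  (* If [s1] is empty it has no points to contradict [nullB]. But then the complex is a single
     point, while a sphere contains with [f q] the different point [- f q]. *)
  have Dpt x : realization D x -> x = q.
    move=> Dx; have xt : supp x \subset [set v0].
      have /realizationP[_ _ xD] := Dx; have := hs1 _ xD; rewrite /t s10 sub0set setU0.
      exact.
    have qt : supp q \subset [set v0] by rewrite supp_barycenter // /t s10 setU0.
    have sing y : realization D y -> supp y \subset [set v0] -> forall v, bary y v = (v == v0)%:R.
      move=> /realizationP[_ y1 _] yt.
      have h v : v != v0 -> bary y v = 0.
        move=> vv0; apply/eqP; apply: contraTT vv0 => yv; rewrite negbK.
        by rewrite -in_set1 (subsetP yt) // in_supp.
      move=> v; case: eqP => [->|/eqP/h//].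
      by rewrite -y1 (bigD1 v0) //= big1 ?addr0.
    by apply: bary_inj => v; rewrite !sing.
  have Sn : @unit_sphere R d (- f q).
    by have := AB _ Dq; rewrite !unit_sphereE dotNl dotNr opprK.
  have E : - f q = f q by rewrite -[LHS]fg // (Dpt (g _)) //; apply: BA.
  have := AB _ Dq; rewrite unit_sphereE => h.
  have : dot (- f q) (f q) = 1 by rewrite E.
  by rewrite dotNl h => /eqP; rewrite lt_eqF // (lt_trans (ltrN10 R) ltr01).
(* The empty face has no points; its alternating sum is that of the whole ball, which is
   contractible. *)
have [s0|s0] := eqVneq s set0.
  have := contractible_euler Ddown (ball_contractible cf cg AB BA gf).
  rewrite s0 /link_euler => h; apply: etrans h.
  apply: eq_big => [G|G _]; first by rewrite sub0set andbT.
  by rewrite setD0.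
have s10 : s1 != set0 by apply: contraNneq s0 => s10; rewrite -subset0 -s10.
have sD : s \in D by apply: Ddown s1D _.
pose p := barycenter s; pose p1 := barycenter s1.
have Dp : realization D p by apply: barycenterP.
have Dp1 : realization D p1 by apply: barycenterP.
have fqi : dot (f q) (f q) < 1.
  have := AB _ Dq; rewrite unit_ballE le_eqVlt => /predU1P[h|//]; case: nq.
  by apply: (homeomorphic_locally_null cf cg) => //; apply: unit_ball_boundary_null.
have bd x : realization D x -> supp x = s1 -> dot (f x) (f x) = 1.
  move=> Dx sx; have := AB _ Dx; rewrite unit_ballE le_eqVlt => /predU1P[//|h]; case: nq.
  apply: (homeomorphic_locally_null cf cg) => //.
  apply: (unit_ball_interior_null fqi h).
  apply: (homeomorphic_locally_null cg cf) => //; first exact: AB.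
  by rewrite gf //; apply: nullp.
(* If [f p] were interior, so would be the image of a point [x] close to [p] on the segment towards
   the barycenter of [s1]. Such an [x] has support [s1], which contradicts [bd]. *)
have fp1 : dot (f p) (f p) = 1.
  have := AB _ Dp; rewrite unit_ballE le_eqVlt => /predU1P[//|h].
  have [r r0 hr] := interior_ball h.
  have [d' d'0 hd'] := proj1 (cont_onP _ _) cf p Dp r r0.
  pose k := Num.min (d' / 2) (1 / 2).
  have k0 : 0 < k by rewrite lt_min !divr_gt0.
  have k1 : k < 1 by rewrite gt_min; apply/orP; right; lra.
  have kd : k < d' by rewrite gt_min; apply/orP; left; lra.
  pose x := segment p1 (k, p).
  have Dx : realization D x.
    apply: realization_segment => //; first by rewrite !ltW.
    by rewrite !supp_barycenter // (setUidPl ss1).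
  have sx : supp x = s1.
    have /realizationP[b10 _ _] := Dp1; have /realizationP[b0 _ _] := Dp.
    apply/setP=> v; rewrite in_supp bary_segment.
    rewrite -[in RHS](supp_barycenter s10) in_supp -/p1.
    have [h1|h1] := eqVneq (bary p1 v) 0.
      have : v \notin s1 by rewrite -(supp_barycenter s10) in_supp negbK; apply/eqP.
      move=> vs1; have : v \notin s by apply: contra vs1; apply: subsetP.
      by rewrite -(supp_barycenter s0) in_supp negbK => /eqP->; rewrite h1 !mulr0 addr0 eqxx.
    rewrite gt_eqF // ltr_wpDl //; first by rewrite mulr_ge0 // subr_ge0 ltW.
    by rewrite mulr_gt0 // lt_def h1 b10.
  have : dot (f x) (f x) < 1.
    apply: hr; apply: hd' => //; apply/ball_baryP => // v; rewrite bary_segment.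
    have -> : bary p v - ((1 - k) * bary p v + k * bary p1 v) = k * (bary p v - bary p1 v) by ring.
    rewrite normrM gtr0_norm //; apply: le_lt_trans kd; rewrite ger_pMr //.
    have /realizationP[/(_ v) b10 _ _] := Dp1; have /realizationP[/(_ v) b0 _ _] := Dp.
    have := bary_le1 v Dp1; have := bary_le1 v Dp.
    by move=> *; rewrite ler_norml; apply/andP; split; lra.
  by rewrite bd // ltxx.
rewrite -(supp_barycenter s0); apply: (locally_null_euler Ddown Dp).
by apply: (homeomorphic_locally_null cf cg) => //; apply: unit_ball_boundary_null.
Qed.

End BallOrSphere.

(** * The K-polynomial of a Stanley-Reisner ring *)

Section Hilbert.
Variables (k : fieldType) (V : finType) (D : {set {set V}}).
Hypothesis Ddown : forall A B : {set V}, A \in D -> B \subset A -> B \in D.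
Implicit Types (a m : 'X_{1..#|V|}) (A : {set V}).

Definition mset A : 'X_{1..#|V|} := [multinom (enum_val i \in A : nat) | i < #|V|].

Definition mnm_supp a : {set V} := [set v | a (enum_rank v) != 0%N].

Lemma msetE A v : mset A (enum_rank v) = (v \in A).
Proof. by rewrite mnmE enum_rankK. Qed.

Lemma mnm_ext a (b : 'X_{1..#|V|}) : (forall v, a (enum_rank v) = b (enum_rank v)) -> a = b.
Proof. by move=> h; apply/mnmP => i; rewrite -(enum_valK i). Qed.

Lemma mset_le A a : (mset A <= a)%MM = (A \subset mnm_supp a).
Proof.
apply/mnm_lepP/subsetP => [h v vA|h i].
  by rewrite inE; have := h (enum_rank v); rewrite msetE vA; case: (a _).
rewrite -(enum_valK i) msetE; case: (boolP (_ \in A)) => // /h; rewrite inE.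
by case: (a _).
Qed.

Lemma mset_sum A : mset A = (\sum_(v in A) U_(enum_rank v))%MM.
Proof.
apply: mnm_ext => u; rewrite msetE mnm_sumE.
case: (boolP (u \in A)) => uA.
  rewrite (bigD1 u) //= mnm1E eqxx big1 // => v /andP[_ vu].
  by rewrite mnm1E (inj_eq enum_rank_inj) (negbTE vu).
rewrite big1 // => v vA; rewrite mnm1E (inj_eq enum_rank_inj).
by case: eqP => // E; rewrite -E vA in uA.
Qed.

Lemma prod_var (B : comNzRingType) A : \prod_(v in A) var B v = 'X_[mset A].
Proof.
rewrite mset_sum; elim/big_ind2: _ => // [|x y z t -> ->]; first by rewrite mpolyX0.
by rewrite mpolyXD.
Qed.

(** The coefficient at [a] of an element of the ideal only involves non-faces [G] contained in the
    support of [a]; there are none if that support is a face. *)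
Lemma monomial_in_ideal (c : k) a : stanley_reisner_ideal D (c *: 'X_[a]) <->
  c = 0 \/ mnm_supp a \notin D.
Proof.
split=> [[q E]|].
  case: (boolP (mnm_supp a \in D)) => [aD|]; last by right.
  left; have := congr1 (fun p => p@_a) E.
  rewrite mcoeffZ mcoeffX eqxx mulr1 => ->; rewrite raddf_sum big1 //= => G GD.
  rewrite prod_var mcoeffM big1 // => -[m1 m2] /= /eqP aE; rewrite mcoeffX.
  case: eqP => [E2|]; last by rewrite mulr0.
  case/negP: GD; apply: Ddown aD _; rewrite -mset_le E2.
  by apply/mnm_lepP => i; have /mnmP/(_ i) -> := aE; rewrite mnmDE leq_addl.
case=> [->|aD].
  exists (fun=> 0); rewrite scale0r big1 // => G _; by rewrite mul0r.
exists (fun G => if G == mnm_supp a then c *: 'X_[a - mset G] else 0).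
rewrite (bigD1 (mnm_supp a)) //= eqxx prod_var big1 => [|G /andP[_ /negbTE->]]; last by rewrite mul0r.
by rewrite addr0 -scalerAl -mpolyXD submK // mset_le.
Qed.

Lemma ideal0 : stanley_reisner_ideal (k := k) D 0.
Proof. by exists (fun=> 0); rewrite big1 // => G _; rewrite mul0r. Qed.

(** Each graded piece is spanned by one monomial, so its image in the quotient has dimension 1 or 0
    according to [monomial_in_ideal]. The forward direction shows that the basis in [has_dim_mod]
    can have no other size. *)
Lemma hilbert_functionP h : is_hilbert_function (stanley_reisner_ideal (k := k) D) h <->
  forall a, h a = (mnm_supp a \in D).
Proof.
split=> [hh a|hh a].
  have [b [hb ind gen]] := hh a; move: (h a) b hb ind gen => d b hb ind gen.
  have [c bE] : exists c : 'I_d -> k, forall i, b i = c i *: 'X_[a].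
    have hb' i : exists x : k, b i == x *: 'X_[a] by have [x ->] := hb i; exists x.
    by exists (fun i => xchoose (hb' i)) => i; apply/eqP/(xchooseP (hb' i)).
  have one i : b i = \sum_j (j == i)%:R *: b j.
    rewrite (bigD1 i) //= eqxx scale1r big1 ?addr0 // => j /negbTE->.
    by rewrite scale0r.
  have notin i : ~ stanley_reisner_ideal D (b i).
    by rewrite one => /ind /(_ i); rewrite eqxx => /eqP; rewrite oner_eq0.
  case: (boolP (mnm_supp a \in D)) => aD; last first.
    by case: d b hb ind gen c bE one notin => // d b _ _ _ c bE _ /(_ ord0) []; rewrite bE;
       apply/monomial_in_ideal; right.
  case: d b hb ind gen c bE one notin => [|[//|d]] b hb ind gen c bE one notin.
    have [|c0] := gen 'X_[a]; first by exists 1; rewrite scale1r.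
    rewrite big_ord0 subr0 -[X in stanley_reisner_ideal _ X]scale1r.
    by move/monomial_in_ideal => [/eqP|]; rewrite ?oner_eq0 ?aD.
  (* Two multiples [c0 x] and [c1 x] of one monomial satisfy the relation with coefficients [c1] and
     [- c0], which excludes two or more basis elements. *)
  exfalso; pose e (i : 'I_d.+2) : k := if i == ord0 then c (lift ord0 ord0)
    else if i == lift ord0 ord0 then - c ord0 else 0.
  have /ind /(_ ord0) : stanley_reisner_ideal D (\sum_i e i *: b i).
    rewrite !big_ord_recl big1 ?addr0 => [|i _]; last by rewrite /e /= scale0r.
    rewrite /e /= !bE !scalerA -scalerDl mulNr [c ord0 * _]mulrC subrr scale0r.
    exact: ideal0.
  rewrite /e eqxx => c0; apply: (notin (lift ord0 ord0)); rewrite bE c0 scale0r.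
  exact: ideal0.
rewrite hh; case: (boolP (mnm_supp a \in D)) => aD.
  exists (fun=> 'X_[a]); split=> [i|c|w [c ->]].
  - by exists 1; rewrite scale1r.
  - rewrite big_ord1 => /monomial_in_ideal [h0 i|]; last by rewrite aD.
    by rewrite ord1.
  - by exists (fun=> c); rewrite big_ord1 subrr; exact: ideal0.
exists (fun=> 0); split=> [[]//|c _ []//|w [c ->]].
exists (fun=> 0); rewrite big_ord0 subr0; apply/monomial_in_ideal; by right.
Qed.

Lemma prod_1_sub_var (H : {set V}) :
  \prod_(v in H) (1 - var int v) =
  \sum_(A : {set V} | A \subset H) (-1) ^+ #|A| *: 'X_[mset A] :> polyring int V.
Proof.
rewrite big_mkcond /=.
transitivity (\prod_(v : V) ((if v \in H then - var int v else 0) + 1) : polyring int V).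
  by apply: eq_bigr => v _; case: ifP; rewrite ?add0r // addrC.
rewrite bigA_distr /= (bigID (fun A : {set V} => A \subset H)) /= [X in _ + X]big1 ?addr0.
  apply: eq_big => // A AH.
  rewrite -big_mkcond /= -prod_var -mul_mpolyC rmorphXn /= rmorphN1.
  rewrite -[in RHS](prodr_const (mem A)) -big_split /=.
  by apply: eq_bigr => v vA; rewrite (subsetP AH) // mulN1r.
by move=> A /subsetPn[v vA vH]; rewrite (bigD1 v) //= vA (negbTE vH) mul0r.
Qed.

(** The denominator has only squarefree terms, one for each set [A], and each [A] contributes the
    single pair of exponents [m - mset A] and [mset A]. *)
Lemma series_mul_prod (f : 'X_{1..#|V|} -> int) m :
  series_mul f (fun a => (\prod_(v : V) (1 - var int v))@_a) m =
  \sum_(A : {set V} | A \subset mnm_supp m) (-1) ^+ #|A| * f (m - mset A)%MM.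
Proof.
have PE a : (\prod_(v : V) (1 - var int v))@_a = \sum_(A : {set V}) (-1) ^+ #|A| * (mset A == a)%:R.
  have -> : \prod_(v : V) (1 - var int v) = \prod_(v in [set: V]) (1 - var int v).
    by apply: eq_bigl => v; rewrite inE.
  rewrite prod_1_sub_var raddf_sum /=; apply: eq_big => [A|A _]; first by rewrite subsetT.
  by rewrite mcoeffZ mcoeffX.
rewrite /series_mul; under [LHS]eq_bigr => c _ do rewrite PE mulr_sumr.
rewrite exchange_big /= [RHS]big_mkcond /=; apply: eq_bigr => A _.
rewrite -mset_le; case: ifP => Am.
  have l1 : (mdeg (m - mset A) < (mdeg m).+1)%N by rewrite ltnS mdegB.
  have l2 : (mdeg (mset A) < (mdeg m).+1)%N by rewrite ltnS -(submK Am) mdegD leq_addl.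
  rewrite (bigD1 (BMultinom l1, BMultinom l2)) /=; last by rewrite submK.
  rewrite eqxx mulr1 mulrC big1 ?addr0 // => -[c1 c2] /= /andP[/eqP mE cc].
  case: eqP => E; rewrite ?mulr0 ?mulr1 //; case/eqP: cc.
  congr pair; apply/val_inj => /=; last by rewrite E.
  by rewrite E [X in (X - _)%MM]mE addmK.
rewrite big1 // => -[c1 c2] /= /eqP mE; case: eqP => E; rewrite ?mulr0 //.
by case/negP: Am; rewrite E; apply/mnm_lepP => i; have /mnmP/(_ i) -> := mE; rewrite mnmDE leq_addl.
Qed.

(** The sum over the faces [G] of the products of [t_v] for [v] in [G] and [1 - t_v] for the other
    [v], expanded in the variables [1 - t_v]. *)
Definition K_sum : polyring int V :=
  \sum_(H : {set V}) link_euler D (~: H) *: \prod_(v in H) (1 - var int v).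

Lemma K_sum_coef m : K_sum@_m =
  \sum_(A : {set V} | mset A == m) (-1) ^+ #|A| * \sum_(H : {set V} | A \subset H) link_euler D (~: H).
Proof.
rewrite /K_sum raddf_sum /=.
under eq_bigr => H _.
  rewrite mcoeffZ prod_1_sub_var raddf_sum /= mulr_sumr.
  under eq_bigr => A _ do rewrite mcoeffZ mcoeffX.
  over.
rewrite (exchange_big_dep xpredT) //= [RHS]big_mkcond; apply: eq_bigr => A _.
case: ifP => _; last by rewrite big1 // => H _; rewrite !mulr0.
by rewrite mulr_sumr; apply: eq_bigr => H _; rewrite mulr1 mulrC.
Qed.

(** After exchanging the sums, a face [G] with a vertex outside [A] contributes zero, by toggling
    that vertex in [H]. If [G] is inside [A], the only remaining [H] is the full set. *)
Lemma sum_link_euler A : \sum_(H : {set V} | A \subset H) link_euler D (~: H) =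
  \sum_(G in D | G \subset A) (-1) ^+ #|G|.
Proof.
rewrite /link_euler (exchange_big_dep (mem D)) /= => [|H G _ /andP[]//].
rewrite [RHS]big_mkcondr /=; apply: eq_bigr => G GD; rewrite GD.
rewrite (eq_bigr (fun H : {set V} => (-1) ^+ #|~: G| * (-1) ^+ #|H|)); last first.
  move=> H /andP[_ GH]; rewrite -(cardsID G H) addnC exprD mulrA.
  have -> : H :\: G = ~: G.
    apply/setP=> v; rewrite !inE; case: (boolP (v \in G)) => //= vG.
    by apply: contraR vG => vH; apply: (subsetP GH); rewrite inE.
  by rewrite -expr2 sqrr_sign mul1r setDE setCK setIC.
rewrite -mulr_sumr; case: ifP => [GA|/negbT/subsetPn[v vG vA]].
  rewrite (big_pred1 setT) => [|H] /=.
    by rewrite cardsT -(cardsC G) addnC exprD mulrA -expr2 sqrr_sign mul1r.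
  apply/andP/eqP => [[AH GH]|->]; last by rewrite !subsetT setCT sub0set.
  apply/setP=> v; rewrite inE; case: (boolP (v \in G)) => vG; first by rewrite (subsetP AH) ?(subsetP GA).
  by apply: contraR vG => vH; apply: (subsetP GH); rewrite inE.
rewrite (@sum_toggle _ v) ?mulr0 // => H; congr (_ && _).
  apply/subsetP/subsetP => h u uA; have := h u uA; rewrite !inE.
    by case: eqP => //= E; rewrite E (negbTE vA) in uA.
  by case: eqP.
apply/subsetP/subsetP => h u; have := h u; rewrite !inE; case: eqP => //= ->; rewrite ?vG //.
Qed.

(** The Hilbert function is determined by [hilbert_functionP], so it remains to compare
    coefficients. In squarefree degree this is [sum_link_euler]; in all other degrees both sides are
    zero. *)
Theorem K_polynomialP (K : polyring int V) :
  is_K_polynomial (stanley_reisner_ideal (k := k) D) K <-> K = K_sum.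
Proof.
have main m : series_mul (fun a => ((mnm_supp a \in D : nat))%:Z)
    (fun a => (\prod_(v : V) (1 - var int v))@_a) m = K_sum@_m.
  rewrite series_mul_prod K_sum_coef.
  have [[A mA]|nA] := pselect (exists A, mset A = m).
    rewrite [RHS](big_pred1 A) => [|B] /=; last first.
      rewrite -mA; apply/eqP/eqP => [/mnmP h|->//]; apply/setP=> v.
      by have := h (enum_rank v); rewrite !msetE; do 2!case: (_ \in _).
    have sA : mnm_supp m = A by apply/setP=> v; rewrite inE -mA msetE; case: (_ \in _).
    rewrite sum_link_euler sA mulr_sumr [RHS]big_mkcond.
    (* Passing to complements in [A] makes [G] the support of the remaining exponent. *)
    rewrite (reindex_onto (fun G => A :\: G) (fun G => A :\: G)) /=; last first.
      by move=> B BA; rewrite setDDr setDv set0U (setIidPr BA).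
    rewrite big_mkcond; apply: eq_bigr => G _.
    rewrite subsetDl /= setDDr setDv set0U.
    have -> : (A :&: G == G) = (G \subset A) by apply/eqP/setIidPr.
    case: ifP => GA; last by rewrite andbF.
    have -> : mnm_supp (m - mset (A :\: G)) = G.
      apply/setP=> v; rewrite inE mnmBE -mA !msetE !inE.
      by case: (boolP (v \in G)) => vG /=; [rewrite (subsetP GA)|case: (_ \in _)].
    rewrite andbT; case: (boolP (G \in D)) => GD; last by rewrite mulr0.
    by rewrite mulr1 -(cardsID G A) (setIidPr GA) exprD mulrAC -expr2 sqrr_sign mul1r.
  rewrite [RHS]big1 => [|A /eqP mA]; last by case: nA; exists A.
  (* A degree that is not squarefree has a vertex [v] of exponent at least 2. Subtracting 1 there
     does not change the support, so toggling [v] cancels all terms. *)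
  have [v v2] : exists v, (1 < m (enum_rank v))%N.
    have [//|nv] := pselect (exists v, (1 < m (enum_rank v))%N).
    case: nA; exists (mnm_supp m); apply: mnm_ext => v; rewrite msetE inE.
    have : ~~ (1 < m (enum_rank v))%N by apply/negP => h; apply: nv; exists v.
    by case: (m _) => [|[]].
  rewrite (eq_bigr (fun A : {set V} => if mnm_supp (m - mset A) \in D then (-1) ^+ #|A| else 0)); last first.
    by move=> A _; case: ifP; rewrite ?mulr1 ?mulr0.
  rewrite -big_mkcondr /=; apply: (@sum_toggle _ v) => A; congr (_ && (_ \in D)).
    apply/subsetP/subsetP => h u; have := h u; rewrite !inE; case: eqP => //= -> //.
    by move=> _ _; case: (m _) v2.
  apply/setP=> u; rewrite !inE !mnmBE !msetE !inE; case: (u =P v) => [->|] //=.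
  by case: (m _) v2 => [|[|j]].
split=> [[h /hilbert_functionP hh hK]|->]; last first.
  exists (fun a => (mnm_supp a \in D : nat)) => //; exact/hilbert_functionP.
apply/mpolyP => m; rewrite -hK -main /series_mul; apply: eq_bigr => c _.
by rewrite hh.
Qed.

End Hilbert.

(** * Tableau complexes *)

(** The sum over all subsets is zero; the omitted empty set would contribute the sign of [#|C|]. *)
Lemma sum_nonempty_subsets (Y : finType) (C : {set Y}) : C != set0 ->
  \sum_(B : {set Y} | (B \subset C) && (B != set0)) (-1) ^+ #|C :\: B| = (-1) ^+ #|C|.-1 :> int.
Proof.
move=> /set0Pn[y yC].
have E : \sum_(B : {set Y} | B \subset C) (-1) ^+ #|B| = 0 :> int.
  apply: (@sum_toggle _ y) => B; apply/subsetP/subsetP => h u; have := h u; rewrite !inE.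
    by case: eqP => //= _ _.
  by case: eqP => //= ->.
have {}E : \sum_(B : {set Y} | B \subset C) (-1) ^+ #|C :\: B| = 0 :> int.
  rewrite (eq_bigr (fun B : {set Y} => (-1) ^+ #|C| * (-1) ^+ #|B|)) => [|B BC].
    by rewrite -mulr_sumr E mulr0.
  by rewrite -(cardsID B C) (setIidPr BC) addnC exprD -mulrA -expr2 sqrr_sign mulr1.
move: E; rewrite (bigD1 set0) ?sub0set //= setD0 => /eqP; rewrite addrC addr_eq0 => /eqP ->.
by rewrite (cardsD1 y) yC add1n exprS mulN1r opprK.
Qed.

(** * Set-valued tableaux row by row *)

Section Entries.
Variables X Y : finType.
Implicit Types (F : {set X * Y}) (f g : {ffun X -> Y}).

Lemma in_graph f e : (e \in graph f) = (e.2 == f e.1).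
Proof.
apply/imsetP/eqP => [[x _ ->] //|]; case: e => x y /= ->.
by exists x.
Qed.

Lemma graph_subP f F : reflect (forall x, (x, f x) \in F) (graph f \subset F).
Proof.
apply: (iffP subsetP) => [h x|h e]; first by apply: h; rewrite in_graph.
by rewrite in_graph; case: e => x y /= /eqP ->.
Qed.

Lemma prod_entries (B : comNzRingType) F (g : X * Y -> B) :
  \prod_(x : X) \prod_(y in entries F x) g (x, y) = \prod_(e in F) g e.
Proof.
rewrite pair_big_dep /=; apply: eq_big => [[x y]|[x y] _] //=.
by rewrite inE.
Qed.

Lemma sum_entries F : (\sum_(x : X) #|entries F x|)%N = #|F|.
Proof.
rewrite -sum1_card; under eq_bigr => x _ do rewrite -sum1_card.
rewrite pair_big_dep /=; apply: eq_bigl => -[x y] /=.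
by rewrite inE.
Qed.

(** A subset of [F] with no empty row is an independent choice of a nonempty subset of each row, so
    the sum is a product over rows. The truncated subtraction is exact, because every row of [F] has
    an entry. *)
Lemma row_full_sum F : (forall x, entries F x != set0) ->
  \sum_(F' : {set X * Y} | (F' \subset F) && [forall x, entries F' x != set0])
    (-1) ^+ #|F :\: F'| = (-1) ^+ (#|F| - #|X|)%N :> int.
Proof.
move=> F0.
pose Q x := [pred B : {set Y} | (B \subset entries F x) && (B != set0)].
transitivity (\prod_(x : X) \sum_(B : {set Y} | Q x B) (-1) ^+ #|entries F x :\: B| : int).
  rewrite bigA_distr_big_dep.
  pose to F' := [ffun x => entries F' x] : {ffun X -> {set Y}}.
  pose from (f : {ffun X -> {set Y}}) := [set e : X * Y | e.2 \in f e.1].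
  rewrite (reindex to) /=; last first.
    exists from => [F' _|f _]; first by apply/setP=> -[x y]; rewrite inE /= ffunE inE.
    by apply/ffunP=> x; rewrite ffunE; apply/setP=> y; rewrite !inE.
  apply: eq_big => [F'|F' _].
    apply/andP/familyP => [[FF' /forallP h] x|h].
      rewrite unfold_in /= ffunE h andbT; apply/subsetP=> y; rewrite !inE; exact: (subsetP FF').
    have h' x : (entries F' x \subset entries F x) && (entries F' x != set0).
      by have := h x; rewrite unfold_in /= ffunE.
    split; last by apply/forallP=> x; have /andP[] := h' x.
    apply/subsetP=> -[x y] e; have /andP[/subsetP/(_ y) + _] := h' x.
    by rewrite !inE; apply.
  rewrite -sum_entries expr_sum; apply: eq_bigr => x _; congr (_ ^+ #|pred_of_set _|).
  by apply/setP=> y; rewrite !inE ffunE !inE.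
under eq_bigr => x _ do rewrite sum_nonempty_subsets //.
rewrite -expr_sum; congr (_ ^+ _); rewrite -sum_entries.
rewrite -[X in (_ - X)%N]sum1_card; apply/eqP; rewrite -(eqn_add2r (\sum_(x : X) 1)%N) subnK.
  rewrite -big_split /=; apply/eqP; apply: eq_bigr => x _.
  by rewrite addn1 prednK // card_gt0.
by apply: leq_sum => x _; rewrite card_gt0.
Qed.

(** Changing [f] into [g] one entry at a time leads from [T] out of it, so some single change leaves
    [T]. *)
Lemma adjacent_tableaux (T : {set {ffun X -> Y}}) f g : f \in T -> g \notin T ->
  exists w (h : {ffun X -> Y}), [/\ h \in T, forall x, h x = f x \/ h x = g x &
    [ffun x => if x == w then g w else h x] \notin T].
Proof.
move=> fT gT.
pose mix (s : seq X) := [ffun x => if x \in s then g x else f x] : {ffun X -> Y}.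
have mixfg s x : mix s x = f x \/ mix s x = g x.
  by rewrite ffunE; case: ifP => _; [right|left].
have : mix (enum X) \notin T.
  by rewrite (_ : mix _ = g) //; apply/ffunP=> x; rewrite ffunE mem_enum.
elim: (enum X) => [|w s IH] hs.
  by case/negP: hs; rewrite (_ : mix _ = f) //; apply/ffunP=> x; rewrite ffunE.
have [sT|/IH//] := boolP (mix s \in T).
exists w, (mix s); split=> //; suff -> : [ffun x => if x == w then g w else mix s x] = mix (w :: s) by [].
by apply/ffunP=> x; rewrite !ffunE inE; case: eqP => [->|].
Qed.

End Entries.

(** * Faces of a tableau complex and their alternating sums *)

Section TableauComplex.
Variables (X Y : finType) (T : {set {ffun X -> Y}}) (E : {set X * Y}).
Hypothesis hE : forall f, f \in T -> graph f \subset E.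
Local Notation V := (vertex E).
Implicit Types (v : V) (G H : {set V}) (F : {set X * Y}).

Lemma cell_exists v : exists e, (e \in E) && (val v == E :\ e).
Proof. by have /imsetP[e eE ->] := valP v; exists e; rewrite eE eqxx. Qed.

(** A vertex is a set [E :\ e]; since [e] is in [E], the removed cell is determined by it. *)
Definition cell v : X * Y := xchoose (cell_exists v).

Lemma cell_in v : cell v \in E.
Proof. by have /andP[] := xchooseP (cell_exists v). Qed.

Lemma val_cell v : val v = E :\ cell v.
Proof. by have /andP[_ /eqP] := xchooseP (cell_exists v). Qed.

Lemma cell_inj : injective cell.
Proof. by move=> u v uv; apply/val_inj; rewrite !val_cell uv. Qed.

Lemma cell_surj e : e \in E -> exists v, cell v = e.
Proof.
move=> eE; have h : E :\ e \in [set E :\ e | e in E] by apply: imset_f.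
exists (exist _ (E :\ e) h : V); set v := exist _ _ _.
have := val_cell v; rewrite /= => /setP /(_ e); rewrite !inE eqxx /= eE andbT => /esym /negbT.
by rewrite negbK => /eqP.
Qed.

Lemma tvar_cell v : tvar E (cell v) = var int v.
Proof. by rewrite /tvar -val_cell valK. Qed.

Definition cells H : {set X * Y} := cell @: H.
Definition verts (F : {set X * Y}) : {set V} := [set v | cell v \in F].

Lemma in_cells v H : (cell v \in cells H) = (v \in H).
Proof. exact: (mem_imset _ _ cell_inj). Qed.

Lemma cells_sub H : cells H \subset E.
Proof. by apply/subsetP=> _ /imsetP[v _ ->]; apply: cell_in. Qed.

Lemma cellsK : cancel cells verts.
Proof. by move=> H; apply/setP=> v; rewrite inE in_cells. Qed.

Lemma vertsK (F : {set X * Y}) : F \subset E -> cells (verts F) = F.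
Proof.
move=> FE; apply/setP=> e; apply/imsetP/idP => [[v + ->]|eF]; first by rewrite inE.
by have [v ve] := cell_surj (subsetP FE _ eF); exists v; rewrite ?inE ve.
Qed.

(** The set-valued tableau behind a face [G] can be taken to be [E :\: cells G], which contains the
    graph of [f] exactly when [f] avoids the cells of [G]. *)
Lemma faceP G : reflect (exists2 f, f \in T & forall v, v \in G -> cell v \notin graph f)
  (G \in tableau_complex T E).
Proof.
have valE v (F : {set X * Y}) : (val v \in [set E :\ e | e in E :\: F]) = (cell v \notin F).
  apply/imsetP/idP => [[e]|cF]; last by exists (cell v); rewrite ?val_cell // inE cF cell_in.
  rewrite inE => /andP[eF eE] ve; suff -> : cell v = e by [].
  have := val_cell v; rewrite ve => /setP /(_ e); rewrite !inE eqxx /= eE andbT => /esym /negbT.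
  by rewrite negbK => /eqP.
apply: (iffP imsetP) => [[F]|[f fT hf]].
  rewrite inE => /andP[FE /existsP[f /andP[fT fF]]] ->; exists f => // v; rewrite inE valE.
  by apply: contra; apply: (subsetP fF).
exists (E :\: cells G).
  rewrite inE subsetDl /=; apply/existsP; exists f; rewrite fT /=.
  apply/subsetP=> e ef; have eE := subsetP (hE fT) _ ef; rewrite inE eE andbT.
  have [v ve] := cell_surj eE; rewrite -ve in_cells; apply/negP => /hf.
  by rewrite ve ef.
by apply/setP=> v; rewrite inE valE inE in_cells cell_in andbT negbK.
Qed.

Lemma tableau_complex_down G H : G \in tableau_complex T E -> H \subset G -> H \in tableau_complex T E.
Proof.
move=> /faceP[f fT hf] HG; apply/faceP; exists f => // v vH.
by apply: hf; apply: (subsetP HG).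
Qed.

Lemma face_complP G : reflect (exists2 f, f \in T & graph f \subset cells (~: G)) (G \in tableau_complex T E).
Proof.
apply: (iffP (faceP G)) => -[f fT hf]; exists f => //.
  apply/subsetP=> e ef; have [v ve] := cell_surj (subsetP (hE fT) _ ef).
  by rewrite -ve in_cells inE; apply/negP => /hf; rewrite ve ef.
by move=> v vG; apply/negP => /(subsetP hf); rewrite in_cells inE vG.
Qed.

Definition full_tableau (F : {set X * Y}) := [&& F \subset E, [forall x, entries F x != set0]
  & [forall f : {ffun X -> Y}, (graph f \subset F) ==> (f \in T)]].

(** Faces containing the complement of [H] correspond to subsets of [cells H] that contain a tableau
    of [T]. All tableaux in [cells H] are in [T], so this only asks for nonempty rows, and
    [row_full_sum] applies. *)
Lemma link_euler_full H : full_tableau (cells H) ->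
  link_euler (tableau_complex T E) (~: H) = (-1) ^+ (#|cells H| - #|X|)%N.
Proof.
move=> /and3P[_ /forallP F0 /forallP FT]; rewrite -row_full_sum // /link_euler.
rewrite [RHS](reindex_onto (fun G : {set V} => cells (~: G)) (fun F => ~: verts F)) /=; last first.
  move=> F /andP[FH _]; rewrite setCK vertsK //; exact: subset_trans FH (cells_sub _).
apply: eq_big => [G|G /andP[_ HG]].
  rewrite cellsK setCK eqxx andbT andbC.
  have -> : (cells (~: G) \subset cells H) = (~: H \subset G).
    rewrite -[RHS]setCS setCK; apply/subsetP/subsetP => h.
      by move=> v; rewrite -!in_cells; apply: h.
    by move=> _ /imsetP[v vG ->]; rewrite in_cells h.
  case: (boolP (~: H \subset G)) => //= HG; apply/face_complP/forallP => [[f fT /graph_subP fG] x|h].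
    by apply/set0Pn; exists (f x); rewrite inE.
  have ex x : exists y, (x, y) \in cells (~: G) by have /set0Pn[y] := h x; rewrite inE; exists y.
  pose f : {ffun X -> Y} := [ffun x => xchoose (ex x)].
  have fG : graph f \subset cells (~: G).
    by apply/graph_subP => x; rewrite ffunE; apply: (xchooseP (ex x)).
  exists f => //; apply: (implyP (FT f)); apply: subset_trans fG _.
  by apply: imsetS; rewrite -setCS setCK.
congr (_ ^+ _); rewrite -(card_imset _ cell_inj); congr #|pred_of_set _|.
apply/setP=> e; apply/imsetP/idP => [[v + ->]|].
  by rewrite !inE !in_cells !inE !negbK andbC.
rewrite inE => /andP[eG /imsetP[v vH ve]]; exists v => //; move: eG.
by rewrite ve in_cells !inE !negbK vH => ->.
Qed.

(** If [cells H] contains no tableau of [T], the sum is empty. Otherwise it also contains one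
    outside [T], and two adjacent tableaux [f1] in [T] and [g1] outside it provide the face [s1]
    required by [ball_or_sphere_link_euler]. *)
Lemma link_euler_not_full (R : realType) H :
  is_ball_or_sphere R (tableau_complex T E) -> ~~ full_tableau (cells H) ->
  link_euler (tableau_complex T E) (~: H) = 0.
Proof.
move=> bs nint.
have [|nf] := boolP (~: H \in tableau_complex T E); last first.
  rewrite /link_euler big_pred0 // => G; apply/negP => /andP[GD HG]; case/negP: nf.
  exact: tableau_complex_down HG.
move=> /face_complP[f fT]; rewrite setCK => /graph_subP fH.
(* Since [f] meets every row of [cells H], the failure to be full can only come from a tableau
   outside [T]. *)
have [g gH gT] : exists2 g : {ffun X -> Y}, graph g \subset cells H & g \notin T.
  move: nint; rewrite /full_tableau cells_sub /= negb_and => /orP[/forallPn[x]|/forallPn[g]].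
    by rewrite negbK => /eqP/setP/(_ (f x)); rewrite !inE fH.
  by rewrite negb_imply => /andP[gH gT]; exists g.
move/graph_subP: gH => gH.
have [w [f1 [f1T f1fg g1T]]] := adjacent_tableaux fT gT.
set g1 := finfun _ in g1T.
have f1H x : (x, f1 x) \in cells H by case: (f1fg x) => ->.
have gw : g w != f1 w.
  apply: contraNneq g1T => gw; suff -> : g1 = f1 by [].
  by apply/ffunP=> x; rewrite ffunE; case: eqP => [->|].
(* The cells off both graphs. The two tableaux differ only in row [w], so adding the cell [(w, g w)]
   gives all cells off the graph of [f1], which is a facet. *)
pose s1 := [set v : V | (cell v \notin graph f1) && (cell v \notin graph g1)].
have [v0 v0E] := cell_surj (subsetP (cells_sub H) _ (gH w)).
have tE : v0 |: s1 = [set v : V | cell v \notin graph f1].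
  apply/setP=> v; rewrite !inE !in_graph; apply/orP/idP => [[/eqP->|/andP[]//]|vf].
    by rewrite v0E.
  rewrite vf /= ffunE; case: (cell v =P (w, g w)) => [E1|vw].
    by left; apply/eqP; apply: cell_inj; rewrite v0E.
  right; case: ifP => [/eqP E1|//]; apply/eqP => E2; apply: vw.
  by rewrite (surjective_pairing (cell v)) E1 E2.
apply: (@ball_or_sphere_link_euler R V _ tableau_complex_down _ s1 v0 bs).
- apply/subsetP=> v; rewrite !inE !in_graph => vH.
  have nH : cell v \notin cells H by rewrite in_cells.
  apply/andP; split; apply: contraNneq nH => E1; rewrite (surjective_pairing (cell v)) E1 //.
  by rewrite ffunE; case: eqP => [->|].
- by rewrite inE !in_graph v0E /= !ffunE !eqxx andbF.
- by rewrite tE; apply/faceP; exists f1 => // v; rewrite inE.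
- move=> G /faceP[h hT hG] s1G; rewrite tE.
  (* A face above [s1] misses a tableau [h] of [T] with entries among those of [f1] and [g1]. So [h]
     is one of these two, and [g1] is not in [T]. *)
  suff hf1 : h = f1 by apply/subsetP=> v /hG; rewrite inE hf1.
  have hfg x : h x = f1 x \/ h x = g1 x.
    have [v vE] := cell_surj (subsetP (hE hT) (x, h x) ltac:(by rewrite in_graph)).
    have : v \notin s1.
      by apply/negP => /(subsetP s1G)/hG; rewrite vE in_graph /= eqxx.
    by rewrite inE vE !in_graph /= negb_and !negbK => /orP[] /eqP; [left|right].
  have hw : h w = f1 w.
    case: (hfg w) => // hw; case/negP: g1T; suff <- : h = g1 by [].
    apply/ffunP=> x; have [->//|xw] := eqVneq x w; case: (hfg x) => // ->.
    by rewrite ffunE (negbTE xw).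
  apply/ffunP=> x; have [->//|xw] := eqVneq x w; case: (hfg x) => // ->.
  by rewrite ffunE (negbTE xw).
Qed.

End TableauComplex.

(** * The K-polynomial of a tableau complex that is a ball or a sphere *)

Theorem theorem4p3 (R : realType) (k : fieldType) (X Y : finType)
    (T : {set {ffun X -> Y}}) (E : {set X * Y})
    (hE : forall f, f \in T -> graph f \subset E)
    (hD : is_ball_or_sphere R (tableau_complex T E))
    (K : polyring int (vertex E)) :
  is_K_polynomial (stanley_reisner_ideal (k := k) (tableau_complex T E)) K <->
  K = \sum_(F : {set X * Y} | [&& F \subset E,
                               [forall x, entries F x != set0]
                             & [forall f : {ffun X -> Y},
                                  (graph f \subset F) ==> (f \in T)]])
        (-1) ^+ (\sum_(x : X) #|entries F x| - #|X|)%N *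
        \prod_(x : X) \prod_(y in entries F x) (1 - tvar E (x, y)).
Proof.
rewrite (K_polynomialP k (tableau_complex_down hE)) /K_sum.
suff -> : \sum_(H : {set vertex E}) link_euler (tableau_complex T E) (~: H) *:
    \prod_(v in H) (1 - var int v) = \sum_(F | full_tableau T E F)
    (-1) ^+ (\sum_(x : X) #|entries F x| - #|X|)%N *
    \prod_(x : X) \prod_(y in entries F x) (1 - tvar E (x, y)) by [].
(* Set-valued tableaux inside [E] are the sets [cells H], so both sums run over sets [H] of vertices
   and are compared term by term. *)
rewrite [RHS](reindex_onto (@cells _ _ E) (@verts _ _ E)) /=; last first.
  by move=> F /and3P[FE _ _]; apply: vertsK.
rewrite [RHS]big_mkcond /=; apply: eq_bigr => H _; rewrite cellsK eqxx andbT.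
case: ifP => [int|/negbT nint]; last by rewrite (link_euler_not_full hE hD nint) scale0r.
rewrite (link_euler_full hE int) sum_entries.
rewrite (prod_entries _ (fun e => 1 - tvar E e)) big_imset /=; last by move=> u v _ _; apply: cell_inj.
rewrite -mul_mpolyC rmorphXn rmorphN1; congr (_ * _); apply: eq_bigr => v _.
by rewrite tvar_cell.
Qed.
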